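(* Let $n\ge 2$ be an integer and let $\mathcal{M}$ be a von Neumann algebra without central summands of type $I_1$. Then a map $\varphi:\mathcal{M}\to\mathcal{M}$ is a bijective unital multiplicative $*$-Jordan $n$-map if and only if $\varphi$ is a $*$-ring isomorphism.
   Context: A von Neumann algebra is a weakly closed, self-adjoint algebra of operators on a complex Hilbert space containing the identity operator $I$. For elements $A,B$ of a $*$-ring, $\{A,B\}_*:=AB+BA^*$ (the $*$-Jordan product). Define $q_{1*}(x)=x$ and $q_{n*}(x_1,\dots,x_n)=\{q_{(n-1)*}(x_1,\dots,x_{n-1}),x_n\}_*$ for $n\ge 2$. A map $\varphi$ (not necessarily additive) is a multiplicative $*$-Jordan $n$-map if $\varphi(q_{n*}(x_1,\dots,x_n))=q_{n*}(\varphi(x_1),\dots,\varphi(x_n))$ for all $x_1,\dots,x_n$. Unital means $\varphi(I)=I$. A $*$-ring isomorphism is a bijective map that is additive, multiplicative and satisfies $\varphi(A^* )=\varphi(A)^*$ (complex linearity is not required). *)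

(* Defs.v *)
From HB Require Import structures.
From mathcomp Require Import all_boot all_order all_algebra sesquilinear.
From mathcomp Require Import complex.
From mathcomp Require Import boolp classical_sets functions reals topology.
From mathcomp Require Import normedtype.

Set Implicit Arguments.
Unset Strict Implicit.
Unset Printing Implicit Defensive.

Import Order.TTheory GRing.Theory Num.Theory.
Import numFieldNormedType.Exports.

Local Open Scope classical_set_scope.
Local Open Scope ring_scope.

(* Complex Hilbert spaces: the norm of a Banach space over R[i] comes from an
   inner product, linear in its first argument. No dimension or separability
   assumption is made. *)
HB.mixin Record CompleteNormedModule_isHilbert (R : realType) H
    of CompleteNormedModule R[i] H := {
  inner : {dot H for (@Num.conj R[i])} ;
  inner_norm : forall x : H, `|x| ^+ 2 = inner x x
}.

#[short(type="hilbertType")]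
HB.structure Definition Hilbert (R : realType) :=
  {H of CompleteNormedModule_isHilbert R H & CompleteNormedModule R[i] H}.

Section BoundedOperators.
Context {R : realType} {H : hilbertType R}.
Implicit Types f g : H -> H.

(* For linear maps, continuity is boundedness (linear_bounded_continuous). *)
Definition is_bounded_op : {pred H -> H} :=
  fun f => `[< linear f /\ continuous f >].

Record bounded_op :=
  BoundedOp { bounded_op_fun :> H -> H ; _ : is_bounded_op bounded_op_fun }.

HB.instance Definition _ := [isSub for bounded_op_fun].
HB.instance Definition _ := [Choice of bounded_op by <:].

Lemma is_bounded_op_submod : submod_closed is_bounded_op.
Proof.
split=> [|a f g /asboolP[lf cf] /asboolP[lg cg]]; apply/asboolP; split.
- by move=> a u v /=; rewrite scaler0 addr0.
- exact: cst_continuous.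
- move=> b u v; rewrite !fctE lf lg.
  by rewrite !scalerDr !scalerA [a * b]mulrC addrACA.
- move=> x; apply: cvgD; last exact: cg.
  by apply: cvgZl_tmp; exact: cf.
Qed.

HB.instance Definition _ :=
  GRing.isSubmodClosed.Build R[i] (H -> H) is_bounded_op
    is_bounded_op_submod.
HB.instance Definition _ := [SubChoice_isSubLmodule of bounded_op by <:].

Lemma bounded_op_linear (A : bounded_op) : linear A.
Proof. by case: A => f /= /asboolP[]. Qed.

Lemma bounded_op_continuous (A : bounded_op) : continuous A.
Proof. by case: A => f /= /asboolP[]. Qed.

Lemma is_bounded_op_id : is_bounded_op id.
Proof. by apply/asboolP; split=> // x; exact: cvg_id. Qed.

Lemma is_bounded_op_comp (A B : bounded_op) : is_bounded_op (A \o B).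
Proof.
apply/asboolP; split=> [a u v /=|x]; first by rewrite !bounded_op_linear.
by apply: continuous_comp; exact: bounded_op_continuous.
Qed.

Definition op_one : bounded_op := BoundedOp is_bounded_op_id.
Definition op_mul (A B : bounded_op) : bounded_op :=
  BoundedOp (is_bounded_op_comp A B).

Lemma op_ext (A B : bounded_op) : (forall x, A x = B x) -> A = B.
Proof. by move=> AB; apply: val_inj; apply/funext. Qed.

Fact op_mulA : associative op_mul.
Proof. by move=> A B C; exact: op_ext. Qed.
Fact op_mul1r : left_id op_one op_mul.
Proof. by move=> A; exact: op_ext. Qed.
Fact op_mulr1 : right_id op_one op_mul.
Proof. by move=> A; exact: op_ext. Qed.
Fact op_mulDl : left_distributive op_mul +%R.
Proof. by move=> A B C; exact: op_ext. Qed.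
Fact op_mulDr : right_distributive op_mul +%R.
Proof.
move=> A B C; apply: op_ext => x /=.
by have := bounded_op_linear A 1 (B x) (C x); rewrite !scale1r.
Qed.

(* Only a pzRingType: 1 = 0 when H is the zero space. *)
HB.instance Definition _ := GRing.Zmodule_isPzRing.Build bounded_op
  op_mulA op_mul1r op_mulr1 op_mulDl op_mulDr.

Lemma op_oneE x : (1 : bounded_op) x = x. Proof. by []. Qed.
Lemma op_mulE (A B : bounded_op) x : (A * B) x = A (B x). Proof. by []. Qed.
Lemma op_addE (A B : bounded_op) x : (A + B) x = A x + B x. Proof. by []. Qed.
Lemma op_scaleE a (A : bounded_op) x : (a *: A) x = a *: A x.
Proof. by []. Qed.

Definition is_adjoint (A B : bounded_op) : Prop :=
  forall x y : H, inner (A x) y = inner x (B y).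

(* Every bounded operator has exactly one adjoint (Riesz), so the default
   value 0 is never used. *)
Definition adj (A : bounded_op) : bounded_op :=
  xget 0 [set B | is_adjoint A B].

End BoundedOperators.

Arguments bounded_op {R} H.

Section VonNeumannAlgebras.
Context {R : realType} {H : hilbertType R}.
Implicit Types (M N : set (bounded_op H)) (A B E F P V : bounded_op H).

(* Closedness in the weak operator topology, through its basic neighbourhoods
   {A | forall (x, y) in s, `|<(A - T) x, y>| < e} with s finite. *)
Definition weakly_closed M : Prop := forall T : bounded_op H,
  (forall (s : seq (H * H)) (e : R), 0 < e ->
     exists2 A, M A & forall p, p \in s ->
       `|inner (A p.1 - T p.1) p.2| < e%:C%C) ->
  M T.

Record von_neumann_algebra M : Prop := VonNeumannAlgebra {
  vna_one : M 1 ;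
  vna_linear : forall (a : R[i]) A B, M A -> M B -> M (a *: A + B) ;
  vna_mul : forall A B, M A -> M B -> M (A * B) ;
  vna_adj : forall A, M A -> M (adj A) ;
  vna_closed : weakly_closed M
}.

Definition projection P : Prop := P * P = P /\ adj P = P.

Definition central_projection M P : Prop :=
  [/\ M P, projection P & forall A, M A -> P * A = A * P].

(* For a central projection P, the algebra MP = PMP, with unit P. *)
Definition central_summand M P : set (bounded_op H) := [set A * P | A in M].

Definition abelian_projection N E : Prop :=
  [/\ N E, projection E &
      forall A B, N A -> N B ->
        (E * A * E) * (E * B * E) = (E * B * E) * (E * A * E)].

(* Murray-von Neumann equivalence relative to N *)
Definition equiv_projection N E F : Prop :=
  exists2 V, N V & adj V * V = E /\ V * adj V = F.

(* The *-algebra N with unit e is of type I_n (n finite): e is the sum of n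
   mutually orthogonal equivalent abelian projections of N. *)
Definition type_I (n : nat) N e : Prop :=
  exists E : 'I_n -> bounded_op H,
    [/\ forall i, abelian_projection N (E i),
        forall i j, equiv_projection N (E i) (E j),
        forall i j, i != j -> E i * E j = 0 &
        \sum_i E i = e].

Definition no_central_summand_type_I1 M : Prop :=
  forall P, central_projection M P -> P != 0 ->
    ~ type_I 1 (central_summand M P) P.

Definition star_jordan A B : bounded_op H := A * B + B * adj A.

(* q_{n*}(x_1, ..., x_n) for n = size s >= 1; foldl gives
   q(x_1, ..., x_n) = star_jordan q(x_1, ..., x_(n-1)) x_n. *)
Definition qstar (s : seq (bounded_op H)) : bounded_op H :=
  if s is x :: s' then foldl star_jordan x s' else 0.

Definition multiplicative_star_jordan_map (n : nat) M
    (phi : bounded_op H -> bounded_op H) : Prop :=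
  forall x : n.-tuple (bounded_op H), (forall i, M (tnth x i)) ->
    phi (qstar x) = qstar (map phi x).

Definition star_ring_isomorphism M
    (phi : bounded_op H -> bounded_op H) : Prop :=
  [/\ set_bij M M phi,
      forall A B, M A -> M B -> phi (A + B) = phi A + phi B,
      forall A B, M A -> M B -> phi (A * B) = phi A * phi B &
      forall A, M A -> phi (adj A) = adj (phi A)].

End VonNeumannAlgebras.

(* Main.v *)
Require Import Defs.
From Stdlib Require Ncring Ncring_tac.
From HB Require Import structures.
From mathcomp Require Import all_boot all_order all_algebra sesquilinear.
From mathcomp Require Import complex ring lra.
From mathcomp Require Import boolp classical_sets functions reals topology.
From mathcomp Require Import normedtype sequences.

(** The product a o b = (a b + b star(a)) / 2 has 1 as a left unit, so feeding 1
    into the first n - 2 arguments turns a unital multiplicative star-Jordan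
    n-map into a bijection phi preserving the binary product o
    ([jordan_of_nmap]). The whole problem is that phi is not assumed additive.

    Algebra. For a projection p, the maps x |-> p o x, x |-> (1 - p) o x and
    x |-> (i p) o x see the Peirce decomposition of the algebra with respect to
    p, and phi intertwines them with the same maps for the projection phi(p).
    This forces phi to respect Peirce components ([pair_corner], [pair_lower],
    [pair_upper]); expanding (p + a) o (1 - p + b) then gives additivity on each
    corner p A (1 - p) ([pair_upperD]). Hence the defect of additivity
    d = phi(x + y) - phi(x) - phi(y) satisfies q d (1 - q) = 0 for every
    projection q, that is, d commutes with all projections; multiplying by
    elements of the corners shows moreover that d annihilates all commutators
    [q, t] ([pairD]). Once phi is additive, comparing the Jordan product
    (self-adjoint first factor) with the Lie product (skew first factor)
    separates the two halves of a b, and phi is multiplicative ([pairM]).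

    All projections are used at once, instead of one projection with core 0 and
    central carrier 1. Two facts about the algebra are then enough: an element
    commuting with all projections is central, and a central element
    annihilating all commutators with projections vanishes.

    Analysis. The first fact ([proj_commute_central]) is a dyadic form of the
    spectral theorem: if 0 <= A <= 1 then 2 A = P + A' with P a projection of
    the algebra and again 0 <= A' <= 1 ([dyadic_step]), so the commutator of A
    with an element commuting with all projections is divided by 2 at each
    step. The projection P separates the signs of T = 2 A - 1; it is the kernel
    projection of |T| - T. Absolute values ([absolute_value]) and kernel
    projections ([kernel_projection]) are limits of increasing sequences of
    polynomials, and such limits stay in a weakly closed algebra
    ([monotone_limit]). For the second fact ([central_annihilator]), the support
    projection Z of the central element cuts out a summand in which all
    projections are central; by the first fact the summand is commutative, that
    is, of type I_1, hence Z = 0. Adjoints exist by the Riesz representation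
    theorem ([riesz]). *)

Set Implicit Arguments.
Unset Strict Implicit.
Unset Printing Implicit Defensive.

Import Order.TTheory GRing.Theory Num.Theory.
Import numFieldNormedType.Exports.

Local Open Scope classical_set_scope.
Local Open Scope ring_scope.

(** * Linear combinations of equations in noncommutative rings *)

#[local] Instance ring_ops (A : pzRingType) :
  @Ncring.Ring_ops A 0 1 +%R *%R (fun x y => x - y) -%R eq := {}.
#[local] Instance ring_laws (A : pzRingType) :
  @Ncring.Ring A _ _ _ _ _ _ _ (ring_ops A).
Proof.
split; do ?[by move=> ? ? -> | by move=> ? ? -> ? ? ->].
- exact: RelationClasses.eq_equivalence.
- by move=> x; exact: (add0r x).
- by move=> x y; exact: (addrC x y).
- by move=> x y z; exact: (addrA x y z).
- by move=> x; exact: (mul1r x).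
- by move=> x; exact: (mulr1 x).
- by move=> x y z; exact: (mulrA x y z).
- by move=> x y z; exact: (mulrDl x y z).
- by move=> x y z; exact: (mulrDr z x y).
- by [].
- by move=> x; exact: (subrr x).
Qed.

Ltac ncring :=
  lazymatch goal with |- @eq ?T ?x ?y =>
    change (@Algebra_syntax.equality T
      (@Ncring.eq_notation T _ _ _ _ _ _ _ (ring_ops _)) x y);
    Ncring_tac.non_commutative_ring
  end.

(** Turns an equation into its difference, so that a linear combination of
    equations with ring coefficients can be written as a term. *)
Definition gap (A : pzRingType) (x y : A) (_ : x = y) := x - y.

Lemma gap0 (A : pzRingType) (x y : A) (e : x = y) : gap e = 0.
Proof. by rewrite /gap e subrr. Qed.

(** [combine e] proves x = y when x - y equals the combination e of gaps; the
    identity is checked in the free ring, and e vanishes since its gaps do. *)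
Ltac combine e :=
  apply: subr0_eq; transitivity e;
  [rewrite /gap; ncring | rewrite !gap0; ncring].

(** * Bijections of star-rings preserving the Jordan star-product *)

Section StarRing.
Context (A : pzRingType) (star : A -> A) (ii half : A).
Implicit Types (x y z p c d : A).
Local Notation "x ^*" := (star x) : ring_scope.
Hypothesis starD : forall x y, (x + y)^* = x^* + y^*.
Hypothesis starM : forall x y, (x * y)^* = y^* * x^*.
Hypothesis starK : involutive star.
Hypothesis star_pos : forall x y, x^* * x + y^* * y = 0 -> x = 0.
Hypothesis iiE : ii * ii = -1.
Hypothesis iiC : forall x, ii * x = x * ii.
Hypothesis star_ii : ii^* = - ii.
Hypothesis halfE : half + half = 1.

Definition is_proj p := p * p = p /\ p^* = p.
Definition central c := forall x : A, c * x = x * c.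

(** The two properties of the ring that replace a well-chosen projection: the
    projections generate it as far as commutation is concerned, and no central
    part of it is commutative. *)
Hypothesis proj_central : forall d,
  (forall p, is_proj p -> d * p = p * d) -> central d.
Hypothesis proj_ann : forall c, central c ->
  (forall p x, is_proj p -> c * (p * x - x * p) = 0) -> c = 0.

Lemma star0 : 0^* = 0.
Proof. by apply: (@addrI _ 0^*); rewrite -starD !addr0. Qed.

Lemma starN x : (- x)^* = - x^*.
Proof. apply/eqP; rewrite -addr_eq0 -starD addNr star0 //. Qed.

Lemma starB x y : (x - y)^* = x^* - y^*.
Proof. by rewrite starD starN. Qed.

Lemma star1 : 1^* = 1.
Proof. by rewrite -[RHS](starK 1) -[in RHS](mul1r 1^*) starM starK mul1r. Qed.

Lemma half_double z : half * z + half * z = z.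
Proof. combine (gap halfE * z). Qed.

Lemma double_inj x y : x + x = y + y -> x = y.
Proof. by move=> e; combine (half * gap e - gap halfE * (x - y)). Qed.

Lemma half_central : central half.
Proof.
by move=> x; apply: double_inj; combine (gap halfE * x - x * gap halfE).
Qed.

Lemma star_half : half^* = half.
Proof. by apply: double_inj; rewrite halfE -starD halfE star1. Qed.

Lemma proj1B p : is_proj p -> is_proj (1 - p).
Proof.
move=> [pp ps]; split; last by rewrite starB star1 ps.
combine (gap pp).
Qed.

Lemma proj_mul0C p q : is_proj p -> is_proj q -> p * q = 0 -> q * p = 0.
Proof. by move=> [_ ps] [_ qs] pq; rewrite -ps -qs -starM pq star0. Qed.

(** The commutator with p is an involution on off-diagonal elements. *)
Lemma offdiag_bracket c p x : central c -> is_proj p -> p * x + x * p = x ->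
  c * (p * (c * (p * x - x * p)) - c * (p * x - x * p) * p) = c * c * x.
Proof.
move=> cC [pp _] px; have pxp : p * x * p = 0 by combine (p * gap px - gap pp * x).
combine (- c * gap (cC p) * (p * x - x * p)
  + c * c * (gap pp * x + x * gap pp - gap pxp - gap pxp + gap px)).
Qed.

(** This product of an element p + a and an element 1 - p + b linearises a + b:
    in the upper corner only the two terms linear in a and b survive. *)
Lemma upper_product p x y z : p * p = p ->
  let r := 1 - p in
  p * ((p + p * x * r) * (r + p * y * r) + (r + p * y * r) * (p + r * z * p)) * r
  = p * x * r + p * y * r.
Proof.
move=> pp r.
have pr : p * r = 0 by rewrite /r; combine (- gap pp).
have rp : r * p = 0 by rewrite /r; combine (- gap pp).
have rr : r * r = r by rewrite /r; combine (gap pp).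
have e1 : p * (p + p * x * r) = p + p * x * r by combine (gap pp * (1 + x * r)).
have e2 : (r + p * y * r) * r = r + p * y * r by combine ((1 + p * y) * gap rr).
have e3 : (p + r * z * p) * r = 0 by combine ((1 + r * z) * gap pr).
combine (gap e1 * (r + p * y * r) * r + (p + p * x * r) * gap e2
  + p * (r + p * y * r) * gap e3
  + gap pr + gap pp * y * r + p * x * gap rr + p * x * gap rp * y * r).
Qed.

Lemma cartesian x : exists h k, [/\ h^* = h, k^* = k & x = h + ii * k].
Proof.
have hC := half_central; have hs := star_half.
exists (half * (x + x^* )), (- (ii * (half * (x - x^* )))); split.
- by rewrite starM starD starK hs; combine (- gap (hC (x + x^* ))).
- rewrite starN !starM starB starK hs star_ii.
  combine (gap (iiC (half * (x - x^* ))) + gap (hC (x - x^* )) * ii).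
- combine (- gap (half_double x) + gap iiE * half * (x - x^* )).
Qed.

(** The product is stated through its double z + z, which avoids carrying
    the factor 1/2 along. *)
Definition jordan_preserving (f : A -> A) := forall x y z,
  z + z = x * y + y * x^* -> f z + f z = f x * f y + f y * (f x)^*.

(** The map comes with its inverse, which has the same properties; results
    stated for a pair (f, g) are then available for (g, f) as well. *)
Definition jordan_pair (f g : A -> A) :=
  [/\ cancel f g, cancel g f, f 1 = 1 & jordan_preserving f].

Lemma jordan_pair_sym f g : jordan_pair f g -> jordan_pair g f.
Proof.
move=> [fK gK f1 fP]; split=> //; first by rewrite -f1 fK.
move=> x y z e; set t := half * (g x * g y + g y * (g x)^*).
have e1 : t + t = g x * g y + g y * (g x)^* by rewrite half_double.
by have := fP _ _ _ e1; rewrite !gK -e => /double_inj <-; rewrite fK.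
Qed.

Section CentralImages.
Context (f g : A -> A) (fg : jordan_pair f g).
Let gK : cancel g f. Proof. by case: fg. Qed.
Let f1 : f 1 = 1. Proof. by case: fg. Qed.
Let fP : jordan_preserving f. Proof. by case: fg. Qed.

Lemma pair0 : f 0 = 0.
Proof.
apply: double_inj; rewrite [RHS]addr0.
have e : 0 + 0 = 0 * g 0 + g 0 * 0^* by rewrite star0; ncring.
by rewrite (fP e) gK; ncring.
Qed.

(** Self-adjointness of x reads x o 1 = x. *)
Lemma pair_sa x : x^* = x -> (f x)^* = f x.
Proof.
move=> xs; have e : x + x = x * 1 + 1 * x^* by rewrite xs; ncring.
have := fP e; rewrite f1 => e'; combine (- gap e').
Qed.

(** Skewness of x reads x o 1 = 0. *)
Lemma pair_skew x : x^* = - x -> (f x)^* = - f x.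
Proof.
move=> xs; have e : 0 + 0 = x * 1 + 1 * x^* by rewrite xs; ncring.
have := fP e; rewrite f1 pair0 => e'; combine (- gap e').
Qed.

(** The skew central elements are those with x o y = 0 for all y. *)
Lemma pair_central_skew x : x^* = - x -> central x -> central (f x).
Proof.
move=> xs xc y; have e : 0 + 0 = x * g y + g y * x^*.
  rewrite xs; combine (- gap (xc (g y))).
have := fP e; rewrite gK pair0 (pair_skew xs) => e'; combine (- gap e').
Qed.

Let J := f ii.

Lemma JC : central J.
Proof. exact: pair_central_skew. Qed.

Lemma starJ : J^* = - J.
Proof. exact: pair_skew. Qed.

(** For self-adjoint x, ii x = x o ii, and the image of ii is central. *)
Lemma pair_ii x : x^* = x -> f (ii * x) = J * f x.
Proof.
move=> xs; have e : ii * x + ii * x = x * ii + ii * x^*.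
  by rewrite xs iiC.
apply: double_inj; rewrite (fP e) (pair_sa xs) -/J; combine (- gap (JC (f x))).
Qed.
End CentralImages.

Section ProjectionImages.
Context (f g : A -> A) (fg : jordan_pair f g).
Let gf := jordan_pair_sym fg.
Let gK : cancel g f. Proof. by case: fg. Qed.
Let fP : jordan_preserving f. Proof. by case: fg. Qed.
Local Notation J := (f ii).

(** The image of ii is invertible: ii is itself the image of a central skew
    element ii w with w self-adjoint, so ii = f(ii) f(w). *)
Lemma J_inj x : J * x = 0 -> x = 0.
Proof.
set w := - (ii * g ii).
have gs : (g ii)^* = - g ii by exact: (pair_skew gf).
have gc : central (g ii) by exact: (pair_central_skew gf).
have ws : w^* = w.
  rewrite /w starN starM gs star_ii; combine (gap (iiC (g ii))).
have iw : ii * w = g ii by rewrite /w; combine (- gap iiE * g ii).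
have := pair_ii fg ws; rewrite iw gK => e e0.
have Jc := JC fg.
combine (gap iiE * x - ii * gap e * x - ii * gap (Jc (f w)) * x - ii * f w * gap e0).
Qed.

(** The image of the skew central element ii x is central; it equals f(ii) f(x),
    where f(ii) is invertible. *)
Lemma pair_central x : x^* = x -> central x -> central (f x).
Proof.
move=> xs xc y; apply: subr0_eq; apply: J_inj.
have c : central (f (ii * x)).
  apply: (pair_central_skew fg); first by rewrite starM xs star_ii mulrN iiC.
  by move=> z; rewrite -mulrA xc mulrA iiC mulrA.
have := c y; rewrite (pair_ii fg) // => cy.
combine (gap cy - gap (JC fg y) * f x).
Qed.

Lemma pair_proj p : is_proj p -> is_proj (f p).
Proof.
move=> [pp ps]; have fs := pair_sa fg ps; split=> //.
have e : p + p = p * p + p * p^* by rewrite ps pp.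
by have := fP e; rewrite fs => /double_inj.
Qed.

Lemma pair_orthogonal p q : is_proj p -> is_proj q -> q * p = 0 -> f q * f p = 0.
Proof.
move=> pp qp qp0; have [fpp fps] := pair_proj pp; have [fqq fqs] := pair_proj qp.
have pq0 := proj_mul0C qp pp qp0.
have e : 0 + 0 = q * p + p * q^* by rewrite (proj2 qp) qp0 pq0.
have := fP e; rewrite (pair0 fg) fqs => e1.
apply: double_inj.
combine (- gap e1 - f q * gap e1 + gap e1 * f q - gap fqq * f p + f p * gap fqq).
Qed.

Lemma pair_fixed p x : is_proj p -> p * x + x * p = x + x ->
  f p * f x + f x * f p = f x + f x.
Proof.
move=> pp; rewrite -{2}(proj2 pp) => /esym /fP ->.
by rewrite (proj2 (pair_proj pp)).
Qed.
End ProjectionImages.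

Section OffDiagonalImages.
Context (f g : A -> A) (fg : jordan_pair f g).
Let gf := jordan_pair_sym fg.
Let fK : cancel f g. Proof. by case: fg. Qed.
Let gK : cancel g f. Proof. by case: fg. Qed.
Let fP : jordan_preserving f. Proof. by case: fg. Qed.
Local Notation J := (f ii).

(** Here 1 - p is the largest projection r with r o p = 0, a
    property which f and its inverse both preserve. *)
Lemma pair_proj1B p : is_proj p -> f (1 - p) = 1 - f p.
Proof.
move=> pp; have [qq qs] := pair_proj fg pp; have [rr rs] := pair_proj fg (proj1B pp).
have q'p := proj1B (pair_proj fg pp); have g'p := pair_proj gf q'p.
have rq0 : f (1 - p) * f p = 0.
  by apply: (pair_orthogonal fg) => //; [exact: proj1B | combine (- gap (proj1 pp))].
have gp0 : g (1 - f p) * p = 0.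
  rewrite -{2}(fK p); apply: (pair_orthogonal gf) => //; combine (- gap qq).
have pg0 := proj_mul0C g'p pp gp0.
have e : (1 - p) * g (1 - f p) + g (1 - f p) * (1 - p) = g (1 - f p) + g (1 - f p).
  combine (- gap gp0 - gap pg0).
have := pair_fixed fg (proj1B pp) e; rewrite gK => e1.
have qr0 := proj_mul0C (conj rr rs) (conj qq qs) rq0.
apply: double_inj; combine (gap e1 + gap rq0 + gap qr0).
Qed.

(** Off-diagonal elements are characterised by p o x = (1 - p) o x = x / 2; since
    f(1/2) is still unknown, only the equality of the two products is transported. *)
Lemma pair_offdiag p x : is_proj p -> p * x + x * p = x ->
  f p * f x + f x * f p = f x.
Proof.
move=> pp px; have [qq qs] := pair_proj fg pp; have [rr rs] := pair_proj fg (proj1B pp).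
have e1 : half * x + half * x = p * x + x * p^* by rewrite half_double (proj2 pp).
have e2 : half * x + half * x = (1 - p) * x + x * (1 - p)^*.
  rewrite half_double (proj2 (proj1B pp)); combine (gap px).
have := fP e1; have := fP e2; rewrite rs qs pair_proj1B // => e3 e4.
apply: double_inj; combine (gap e3 - gap e4).
Qed.

End OffDiagonalImages.

Section Doubling.
Context (f g : A -> A) (fg : jordan_pair f g).
Let gf := jordan_pair_sym fg.
Let gK : cancel g f. Proof. by case: fg. Qed.
Let fP : jordan_preserving f. Proof. by case: fg. Qed.
Local Notation J := (f ii).

(** The central element 2 f(1/2) - 1 annihilates the off-diagonal elements of
    every projection, in particular all commutators with projections. *)
Lemma pair_half : f half = half.
Proof.
have hC := half_central; have hs := star_half.
set k := f half + f half - 1.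
have kc : central k.
  have c := pair_central fg hs hC.
  move=> x; rewrite /k; combine (gap (c x) + gap (c x)).
suff : k = 0 by move/subr0_eq=> e; apply: double_inj; rewrite halfE.
apply: proj_ann => // q y qp.
set z := q * y - y * q; set p := g q; have pp : is_proj p by exact: (pair_proj gf).
have zoff : q * z + z * q = z.
  by rewrite /z; combine (gap (proj1 qp) * y - y * gap (proj1 qp)).
have xoff := pair_offdiag gf qp zoff.
have e1 : half * g z + half * g z = p * g z + g z * p^*.
  by rewrite half_double (proj2 pp).
have e2 : half * g z + half * g z = half * g z + g z * half^* by rewrite hs hC.
have := fP e1; rewrite (fP e2) !gK (pair_sa fg hs) (proj2 qp) => e3.
have c := pair_central fg hs hC z.
rewrite /k; combine (gap e3 + gap c + gap zoff).
Qed.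

Lemma pair_double x : f (x + x) = f x + f x.
Proof.
have hs := star_half.
have e : x + x = half * (x + x) + (x + x) * half^*.
  rewrite hs; combine (- gap halfE * x - x * gap halfE).
have := fP e; rewrite pair_half hs => e1.
have hC := half_central.
set y := f (x + x) in e1 *.
combine (- gap e1 + gap (hC y) - gap (half_double y)).
Qed.

(** Doubling being preserved, the division by 2 disappears from the product. *)
Lemma pair_jordan x y : f (x * y + y * x^*) = f x * f y + f y * (f x)^*.
Proof.
set z := x * y + y * x^*.
have e : half * z + half * z = x * y + y * x^* by rewrite half_double.
by rewrite -(fP e) -pair_double half_double.
Qed.
End Doubling.

Section Additivity.
Context (f g : A -> A) (fg : jordan_pair f g).
Let gf := jordan_pair_sym fg.
Let gK : cancel g f. Proof. by case: fg. Qed.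
Let f1 : f 1 = 1. Proof. by case: fg. Qed.
Let fJ := pair_jordan fg.
Local Notation J := (f ii).

Lemma star_N1 : (-1)^* = -1.
Proof. by rewrite starN star1. Qed.

Lemma pair_opp_scale x : f (- x) = f (-1) * f x.
Proof.
have sc : central (f (-1)).
  by apply: (pair_central fg) star_N1 _ => y; ncring.
apply: double_inj; rewrite -(pair_double fg).
have := fJ (-1) x; rewrite star_N1 (pair_sa fg star_N1) => e.
have -> : - x - x = -1 * x + x * -1 by ncring.
combine (gap e - gap (sc (f x))).
Qed.

(** The product of ii p and x is, up to a central factor, the commutator [p, x]. *)
Lemma pair_commutator p x : is_proj p ->
  f (ii * (p * x - x * p)) = J * (f p * f x - f x * f p).
Proof.
move=> pp; have [_ ps] := pp; have [_ qs] := pair_proj fg pp.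
have ips : (ii * p)^* = - (ii * p) by rewrite starM ps star_ii mulrN iiC.
have := fJ (ii * p) x; rewrite (pair_skew fg ips) (pair_ii fg ps).
have -> : ii * p * x + x * (ii * p)^* = ii * (p * x - x * p).
  rewrite ips; combine (gap (iiC x) * p).
move=> ->; combine (gap (JC fg (f x)) * f p).
Qed.

(** Bracketing an off-diagonal x twice with ii p gives - x, and bracketing its
    image twice with f(ii) f(p) gives f(ii)^2 f(x); so f(-1) = f(ii)^2 is at the
    same time a self-adjoint square root of 1 and the square of a skew element,
    which leaves only - 1. *)
Lemma pair_N1 : f (-1) = -1 /\ J * J = -1.
Proof.
have sc : central (f (-1)).
  by apply: (pair_central fg) star_N1 _ => y; ncring.
have Jc := JC fg; have Js := starJ fg.
have ss := pair_sa fg star_N1.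
have sJ : f (-1) - J * J = 0.
  apply: proj_ann => [y|q y qp].
    combine (gap (sc y) - J * gap (Jc y) - gap (Jc y) * J).
  set z := q * y - y * q; set p := g q; have pp : is_proj p by exact: (pair_proj gf).
  have zoff : q * z + z * q = z.
    by rewrite /z; combine (gap (proj1 qp) * y - y * gap (proj1 qp)).
  have := pair_offdiag gf qp zoff; rewrite -/p; set x := g z => xoff.
  have := offdiag_bracket iiC pp xoff; rewrite iiE => /(congr1 f).
  rewrite !(pair_commutator _ pp) !gK offdiag_bracket // => e.
  have := pair_opp_scale x; rewrite gK => e'.
  have e2 : -1 * x = - x by ncring.
  rewrite e2 in e; combine (- gap e - gap e').
have s2 : f (-1) * f (-1) = 1 by rewrite -pair_opp_scale opprK f1.
have sN1 : f (-1) + 1 = 0.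
  (* Y = f(-1) + 1 satisfies f(-1) Y = Y, so star(J Y) J Y = - Y f(-1) Y = - star(Y) Y *)
  apply: (@star_pos _ (J * (f (-1) + 1))).
  rewrite starM starD star1 ss Js.
  combine ((f (-1) + 1) * gap sJ * (f (-1) + 1)
   - f (-1) * gap s2 - gap s2).
by split; [combine (gap sN1) | combine (gap sN1 - gap sJ)].
Qed.

Lemma pair_opp x : f (- x) = - f x.
Proof. by rewrite pair_opp_scale (proj1 pair_N1); ncring. Qed.

Lemma pair_sym p : is_proj p -> f (p - (1 - p)) = f p - (1 - f p).
Proof.
move=> pp; have [qq qs] := pair_proj fg pp; have [ee es] := pp.
have := fJ p (p - (1 - p)); have := fJ (1 - p) (p - (1 - p)).
have -> : p * (p - (1 - p)) + (p - (1 - p)) * p^* = p + p.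
  rewrite es; combine (gap ee + gap ee + gap ee + gap ee).
have -> : (1 - p) * (p - (1 - p)) + (p - (1 - p)) * (1 - p)^* = - ((1 - p) + (1 - p)).
  rewrite starB star1 es; combine (- gap ee - gap ee - gap ee - gap ee).
rewrite pair_opp !(pair_double fg) (pair_proj1B fg) // starB star1 !qs.
by move=> e1 e2; apply: double_inj; combine (- gap e1 - gap e2).
Qed.

(** The symmetry p - (1 - p) kills the off-diagonal part, and a further product
    with p isolates the corner p x p. *)
Lemma pair_corner p x : is_proj p -> f (p * x * p) = f p * f x * f p.
Proof.
move=> pp; have [qq qs] := pair_proj fg pp; have [ee es] := pp.
set s := p - (1 - p); set u := s * x + x * s.
have ss : s^* = s by rewrite !starB star1 es.
have fu : f u = (f p - (1 - f p)) * f x + f x * (f p - (1 - f p)).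
  by have := fJ s x; rewrite ss (pair_sa fg ss) pair_sym.
have := fJ p u; rewrite es qs fu.
have -> : p * u + u * p = p * x * p + p * x * p + (p * x * p + p * x * p).
  rewrite /u /s; combine (gap ee * x + gap ee * x + x * gap ee + x * gap ee).
rewrite !(pair_double fg) => e; do 2!apply: double_inj.
combine (gap e + gap qq * f x + gap qq * f x + f x * gap qq + f x * gap qq).
Qed.

(** Left products with self-adjoint diagonal elements cannot separate the two
    off-diagonal corners, being compatible with the adjoint. The corners are
    separated by putting off-diagonal elements y on the left: y o (1 - p) = 0 says
    that y lies in the lower corner, and y o p depends on its lower part only. *)
Lemma pair_lower p x : is_proj p -> f ((1 - p) * x * p) = (1 - f p) * f x * f p.
Proof.
move=> pp; have [qq qs] := pair_proj fg pp; have [ee es] := pp.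
set b := (1 - p) * x * p; set o := b + p * x * (1 - p).
have boff : p * b + b * p = b.
  rewrite /b; combine (- gap ee * x * p + (1 - p) * x * gap ee).
have fboff := pair_offdiag fg pp boff.
have b0 : b * (1 - p) + (1 - p) * b^* = 0.
  rewrite /b !starM starB star1 es.
  combine (- (1 - p) * x * gap ee - gap ee * x^* * (1 - p)).
have o0 : o * p + p * o^* = b * p + p * b^*.
  rewrite /o /b starD !starM !starB star1 es.
  combine (- p * x * gap ee - gap ee * x^* * p).
(* o is obtained from x by products with p and 1 - p, which f carries over *)
have fo : f o = (1 - f p) * f x * f p + f p * f x * (1 - f p).
  have := fJ (1 - p) (p * x + x * p); rewrite (pair_proj1B fg) // !starB !star1 es qs.
  have := fJ p x; rewrite es qs => -> e.
  have -> : o = (1 - p) * (p * x + x * p) + (p * x + x * p) * (1 - p).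
    rewrite /o /b; combine (gap ee * x + x * gap ee).
  rewrite e; combine (- gap qq * f x - f x * gap qq).
have := fJ b (1 - p); rewrite b0 (pair0 fg) (pair_proj1B fg) // => e1.
(* the upper part of o disappears when o is multiplied by p on the right *)
have e2 : f o * f p + f p * (f o)^* = f b * f p + f p * (f b)^*.
  by rewrite -!fJ o0.
have e3 : f p * f b * f p = 0 by combine (f p * gap fboff - gap qq * f b).
have e4 : f p * f b = 0.
  combine (- f p * gap e1 + gap qq * (f b)^* + gap e3).
combine (- gap fboff + gap e4 + gap e3 - (1 - f p) * gap e2
  - gap qq * ((f o)^* - (f b)^* ) + (1 - f p) * gap fo * f p
  + gap qq * f x * f p * f p + (1 - f p) * f x * gap qq + gap qq * f x * gap qq).
Qed.

Lemma pair_upper p x : is_proj p -> f (p * x * (1 - p)) = f p * f x * (1 - f p).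
Proof.
move=> pp; have := pair_lower x (proj1B pp).
by rewrite (pair_proj1B fg) // !subKr.
Qed.

Lemma pair_peirce p x : is_proj p ->
  f x = f (p * x * p) + f (p * x * (1 - p)) +
        (f ((1 - p) * x * p) + f ((1 - p) * x * (1 - p))).
Proof.
move=> pp; rewrite pair_corner // pair_upper // pair_lower //.
by rewrite pair_corner ?(pair_proj1B fg) //; [ncring | exact: proj1B].
Qed.

Lemma pair_peirceD p x y z t : is_proj p ->
  f (p * x * p + p * y * (1 - p) + ((1 - p) * z * p + (1 - p) * t * (1 - p))) =
  f (p * x * p) + f (p * y * (1 - p)) +
    (f ((1 - p) * z * p) + f ((1 - p) * t * (1 - p))).
Proof.
move=> pp; have [ee _] := pp; set s := _ + _.
rewrite (pair_peirce s pp).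
have p1p : p * (1 - p) = 0 by combine (- gap ee).
have p1p' : (1 - p) * p = 0 by combine (- gap ee).
have [rr _] := proj1B pp.
rewrite /s; move: (1 - p) p1p p1p' rr => r pr rp rr.
congr (f _ + f _ + (f _ + f _)); rewrite !mulrDr !mulrDl !mulrA.
- by rewrite ee pr !mul0r !addr0 -!mulrA ee rp !mulr0 addr0.
- by rewrite ee pr !mul0r !addr0 -!mulrA rr pr !mulr0 add0r.
- by rewrite rr rp !mul0r !add0r -!mulrA ee rp !mulr0 addr0.
- by rewrite rr rp !mul0r !add0r -!mulrA rr pr !mulr0 add0r.
Qed.

Lemma pair_upperD p x y : is_proj p ->
  f (p * x * (1 - p) + p * y * (1 - p)) = f (p * x * (1 - p)) + f (p * y * (1 - p)).
Proof.
move=> pp; have [ee es] := pp; have [qq qs] := pair_proj fg pp.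
have [rr rs] := proj1B pp.
set a := p * x * (1 - p); set b := p * y * (1 - p).
have fX : f (p + a) = f p + f a.
  have := pair_peirceD 1 x 0 0 pp.
  by rewrite !mulr0 !mul0r (pair0 fg) !addr0 mulr1 ee.
have fY : f (1 - p + b) = 1 - f p + f b.
  have := pair_peirceD 0 y 0 1 pp; rewrite !mulr0 !mul0r (pair0 fg) !add0r mulr1 rr.
  by rewrite (pair_proj1B fg) // ![_ + (1 - _)]addrC.
set z := (p + a) * (1 - p + b) + (1 - p + b) * (p + a)^*.
have -> : a + b = p * z * (1 - p).
  by rewrite /z starD !starM rs es mulrA upper_product.
rewrite pair_upper // /z fJ fX fY starD (pair_upper x) // (pair_upper y) //.
by rewrite !starM starB star1 qs mulrA upper_product.
Qed.

(** Additivity on upper corners gives q d (1 - q) = 0 for each projection q;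
    used for q and 1 - q this says that d commutes with q. *)
Lemma pairD_central x y : central (f (x + y) - f x - f y).
Proof.
apply: proj_central => q qp; set d := f (x + y) - f x - f y.
have qdr r : is_proj r -> r * d * (1 - r) = 0.
  move=> rp; have pp := pair_proj gf rp.
  have := pair_upperD x y pp; rewrite -mulrDl -mulrDr !pair_upper // gK => e.
  rewrite /d; combine (gap e).
have e1 := qdr _ qp; have := qdr _ (proj1B qp); rewrite subKr => e2.
combine (gap e2 - gap e1).
Qed.

(** For a in p A p and c in p A (1 - p) the product a c + c a* is just a c, so f
    is multiplicative there; since f is additive on p A (1 - p), the defect d
    annihilates q A (1 - q) for all projections q, hence all commutators [q, t]. *)
Lemma pairD x y : f (x + y) = f x + f y.
Proof.
have := pairD_central x y.
set d := f (x + y) - f x - f y => dc.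
suff : d = 0 by rewrite /d => e; combine (gap e).
apply: proj_ann => // q t qp.
have qtr r u : is_proj r -> d * (r * u * (1 - r)) = 0.
  move=> rp; have pp := pair_proj gf rp; set p := g r; set v := g u.
  have pE : f p = r by rewrite gK.
  have [ee es] := pp; have [rr rs] := rp.
  have mul_upper z :
      f (p * z * p * (p * v * (1 - p))) = r * f z * r * (r * u * (1 - r)).
    have := fJ (p * z * p) (p * v * (1 - p)).
    rewrite pair_corner // pair_upper // pE gK.
    rewrite !starM es rs.
    have -> : p * v * (1 - p) * (p * (z^* * p)) = 0.
      combine (- p * v * gap ee * z^* * p).
    rewrite addr0 => ->; combine (- r * u * gap rr * (f z)^* * r).
  have pv z : p * z * p * (p * v * (1 - p)) = p * (z * p * p * v) * (1 - p).
    by rewrite !mulrA.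
  have := mul_upper (x + y).
  rewrite mulrDr !mulrDl !pv pair_upperD // -!pv !mul_upper => e.
  have dr := dc r; rewrite /d in dr *.
  combine (- gap e + gap dr * r * r * u * (1 - r)
    - (f (x + y) - f x - f y) * (gap rr * r + gap rr) * u * (1 - r)).
have e1 := qtr _ t qp; have := qtr _ t (proj1B qp); rewrite subKr => e2.
combine (gap e1 - gap e2).
Qed.

Lemma pair_star x : f (x^*) = (f x)^*.
Proof.
have := fJ x 1; rewrite f1 mulr1 !mul1r mulr1 pairD => e; combine (gap e).
Qed.

Lemma pair_scale_ii x : f (ii * x) = J * f x.
Proof.
have [h [k [hsa ksa xE]]] := cartesian x.
have -> : ii * x = ii * h - k by rewrite xE; combine (gap iiE * k).
have -> : f x = f h + J * f k by rewrite -(pair_ii fg) // -pairD -xE.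
rewrite pairD pair_opp (pair_ii fg) //.
combine (- gap (proj2 pair_N1) * f k).
Qed.

(** Jordan product with x and Lie product with ii x, added together. *)
Lemma pairM_sa x y : x^* = x -> f (x * y) = f x * f y.
Proof.
move=> xs; have fs := pair_sa fg xs.
have := fJ x y; rewrite xs fs => e1.
have := fJ (ii * x) y; rewrite (pair_skew fg); last first.
  by rewrite starM xs star_ii mulrN iiC.
have -> : ii * x * y + y * (ii * x)^* = ii * (x * y - y * x).
  rewrite starM xs star_ii; combine (gap (iiC y) * x + y * gap (iiC x)).
rewrite !pair_scale_ii pairD pair_opp => e2.
apply: double_inj; apply: subr0_eq; apply: (J_inj fg).
rewrite pairD in e1.
combine (J * gap e1 + gap e2 + gap (JC fg (f y)) * f x).
Qed.

Lemma pairM x y : f (x * y) = f x * f y.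
Proof.
have [h [k [hs ks ->]]] := cartesian x.
by rewrite mulrDl !pairD -mulrA !pair_scale_ii !pairM_sa // mulrDl mulrA.
Qed.

Lemma jordan_pair_star_morphism :
  [/\ forall x y, f (x + y) = f x + f y, forall x y, f (x * y) = f x * f y &
      forall x, f (x^*) = (f x)^*].
Proof. by split; [exact: pairD | exact: pairM | exact: pair_star]. Qed.
End Additivity.
End StarRing.

(** * The real inner product and the Riesz representation *)

Section RealInner.
Context {R : realType} {H : hilbertType R}.
Implicit Types x y z : H.

Lemma Re_scale (a : R) (z : R[i]) : complex.Re (a%:C%C * z) = a * complex.Re z.
Proof. by case: z => u v /=; rewrite mul0r subr0. Qed.

Lemma posc_real (c : R[i]) : 0 < c -> exists2 a : R, 0 < a & c = a%:C%C.
Proof. by case: c => a b; rewrite ltcE /= => /andP[/eqP-> h]; exists a. Qed.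

(** Real parts of inner products determine the complex ones, and keep all
    estimates in the ordered field R. *)
Definition rdot x y : R := complex.Re (inner x y).
Definition sqnorm x : R := rdot x x.

Lemma rdotDl x y z : rdot (x + y) z = rdot x z + rdot y z.
Proof. by rewrite /rdot linearDl raddfD. Qed.

Lemma rdotNl x z : rdot (- x) z = - rdot x z.
Proof. by rewrite /rdot linearNl raddfN. Qed.

Lemma rdot0l x : rdot 0 x = 0.
Proof. by rewrite /rdot linear0l. Qed.

Lemma rdotC x y : rdot x y = rdot y x.
Proof. rewrite /rdot hermC /= expr0 mul1r. by case: (inner y x). Qed.

Lemma rdotZl a x z : rdot (a%:C%C *: x) z = a * rdot x z.
Proof. by rewrite /rdot linearZl_LR Re_scale. Qed.

Lemma rdotDr x y z : rdot x (y + z) = rdot x y + rdot x z.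
Proof. by rewrite !(rdotC x) rdotDl. Qed.
Lemma rdotNr x z : rdot x (- z) = - rdot x z.
Proof. by rewrite !(rdotC x) rdotNl. Qed.
Lemma rdotZr a x z : rdot x (a%:C%C *: z) = a * rdot x z.
Proof. by rewrite !(rdotC x) rdotZl. Qed.

Lemma inner_im x y : inner x y = (rdot x y +i* rdot x ('i%C *: y))%C.
Proof.
rewrite /rdot linearZr_LR /= /Num.conj /=; move: (inner x y) => [a b] /=.
by congr Complex; ring.
Qed.

Lemma rdotZc (a : R[i]) x y : rdot x (a *: y) = rdot (Num.conj a *: x) y.
Proof. by rewrite /rdot linearZl_LR linearZr_LR. Qed.

Lemma rdot_ii x y : rdot ('i%C *: x) ('i%C *: y) = rdot x y.
Proof.
rewrite /rdot linearZl_LR linearZr_LR /=; case: (inner x y) => a b /=; ring.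
Qed.

Lemma inner_sqnorm x : inner x x = (sqnorm x)%:C%C.
Proof.
have : 0 <= inner x x by rewrite dnorm_ge0.
by rewrite /sqnorm /rdot; case: (inner x x) => a b; rewrite lecE /= => /andP[/eqP-> _].
Qed.

Lemma norm_sqnorm x : `|x| ^+ 2 = (sqnorm x)%:C%C.
Proof. by rewrite inner_norm inner_sqnorm. Qed.

Lemma sqnorm_ge0 x : 0 <= sqnorm x.
Proof. by rewrite -ler0c -norm_sqnorm exprn_ge0. Qed.

Lemma sqnorm_eq0 x : sqnorm x = 0 -> x = 0.
Proof. by move=> e; apply/normr0_eq0/eqP; rewrite -sqrf_eq0 norm_sqnorm e. Qed.

Lemma norm_lt x (e : R) : 0 < e -> (`|x| < e%:C%C) = (sqnorm x < e ^+ 2).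
Proof.
move=> e0; rewrite -ltcR -norm_sqnorm rmorphXn /= ltr_pXn2r ?nnegrE ?normr_ge0 //.
by rewrite ler0c ltW.
Qed.

Lemma sqnormD x y : sqnorm (x + y) = sqnorm x + 2 * rdot x y + sqnorm y.
Proof. rewrite /sqnorm !(rdotDl, rdotDr) (rdotC y x); ring. Qed.
Lemma sqnormN x : sqnorm (- x) = sqnorm x.
Proof. by rewrite /sqnorm rdotNl rdotNr opprK. Qed.
Lemma sqnormZ a x : sqnorm (a%:C%C *: x) = a ^+ 2 * sqnorm x.
Proof. by rewrite /sqnorm rdotZl rdotZr mulrA expr2. Qed.
Lemma sqnorm_ii x : sqnorm ('i%C *: x) = sqnorm x.
Proof. exact: rdot_ii. Qed.

Lemma rdot_cauchy x y : rdot x y ^+ 2 <= sqnorm x * sqnorm y.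
Proof.
have [y0|yN0] := eqVneq (sqnorm y) 0.
  by rewrite (sqnorm_eq0 y0) /rdot linear0r /= expr0n mulr_ge0 ?sqnorm_ge0.
have yp : 0 < sqnorm y by rewrite lt_def yN0 sqnorm_ge0.
have := sqnorm_ge0 ((sqnorm y)%:C%C *: x - (rdot x y)%:C%C *: y).
rewrite sqnormD sqnormN !sqnormZ rdotNr rdotZl rdotZr => h.
rewrite -subr_ge0 -(pmulr_rge0 _ yp); apply: le_trans h _; rewrite le_eqVlt.
by apply/orP; left; apply/eqP; ring.
Qed.

Lemma rdot_inj x y : (forall z, rdot x z = rdot y z) -> x = y.
Proof.
move=> e; apply/subr0_eq/sqnorm_eq0; rewrite /sqnorm rdotDl rdotNl e subrr //.
Qed.


Lemma sqnorm_complete (u : nat -> H) :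
  (forall e, 0 < e -> exists N, forall m n, (N <= m)%N -> (N <= n)%N ->
     sqnorm (u m - u n) < e) -> exists l : H, u @ \oo --> l.
Proof.
move=> uc; suff : cvg (u @ \oo) by move=> c; exists (lim (u @ \oo)).
apply/cauchy_cvgP/cauchy_ballP => e e0.
have [r r0 {e e0}->] := posc_real e0.
have [N uN] := uc _ (exprn_gt0 2 r0).
pose B := u @` [set n | (N <= n)%N]; exists (B, B) => /=.
  by split; exists N => // n Nn; exists n.
move=> [_ _] [/= [m /= Nm <-] [n /= Nn <-]].
by rewrite -ball_normE /= norm_lt ?uN.
Qed.

Lemma cvg_sqnorm (u : nat -> H) (l : H) : u @ \oo --> l -> forall e, 0 < e ->
  \forall n \near \oo, sqnorm (u n - l) < e.
Proof.
move=> /cvgrPdist_lt ul e e0.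
have s0 : 0 < Num.sqrt e by rewrite sqrtr_gt0.
have := ul (Num.sqrt e)%:C%C; rewrite ltcR => /(_ s0); apply: filterS => n.
by rewrite norm_lt // sqr_sqrtr ?ltW // -sqnormN opprB.
Qed.

Lemma cvg_rdot (u : nat -> H) (l z : H) : u @ \oo --> l ->
  rdot (u n) z @[n --> \oo] --> rdot l z.
Proof.
move=> ul; apply/cvgrPdist_lt => e e0.
have z0 : 0 < sqnorm z + 1 by rewrite ltr_wpDl ?sqnorm_ge0.
have := cvg_sqnorm ul (divr_gt0 (exprn_gt0 2 e0) z0); apply: filterS => n h.
rewrite /= -rdotNl -rdotDl -[ltRHS](@ger0_norm _ e) ?ltW //.
rewrite -ltr_sqr ?nnegrE // !real_normK ?num_real //.
apply: le_lt_trans (rdot_cauchy _ _) _.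
rewrite -sqnormN opprB.
rewrite ltr_pdivlMr // in h; apply: le_lt_trans h.
by rewrite ler_wpM2l ?sqnorm_ge0 // lerDl.
Qed.

(** The functional is represented by the minimiser of |x|^2 - 2 f(x), obtained
    as the limit of a minimising sequence. *)
Lemma riesz (f : H -> R) (k : R) : 0 <= k ->
  (forall x y, f (x + y) = f x + f y) -> (forall a x, f (a%:C%C *: x) = a * f x) ->
  (forall x, f x ^+ 2 <= k * sqnorm x) -> exists z, forall x, f x = rdot x z.
Proof.
move=> k0 fD fZ fk.
have fN x : f (- x) = - f x.
  by rewrite -mulN1r -fZ rmorphN1 scaleN1r.
pose q x := sqnorm x - 2 * f x.
have q_lb : has_lbound (range q).
  exists (- k) => _ [x _ <-]; rewrite /q leNgt; apply/negP => h.
  have n0 := sqnorm_ge0 x; have s0 : 0 <= sqnorm x + k by rewrite addr_ge0.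
  have h0 : sqnorm x + k < 2 * f x by lra.
  have : (sqnorm x + k) ^+ 2 < (2 * f x) ^+ 2.
    by rewrite ltr_sqr ?nnegrE // ltW // (le_lt_trans s0).
  have := fk x; have := sqr_ge0 (sqnorm x - k); rewrite !expr2; lra.
have q_inf x : inf (range q) <= q x by apply: ge_inf => //; exists x.
have qne : has_inf (range q) by split=> //; exists (q 0), 0.
have q_near n : exists x, q x < inf (range q) + n.+1%:R^-1.
  have n0 : 0 < n.+1%:R^-1 :> R by rewrite invr_gt0.
  by have [_ [x _ <-] qx] := inf_adherent n0 qne; exists x.
have [u uq] := boolp.choice q_near.
set m := inf (range q) in q_inf uq.
have [l ul] : exists l : H, u @ \oo --> l.
  apply: sqnorm_complete => e e0.
  have e4 : 0 < e / 4 by rewrite divr_gt0.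
  have [N] := ltr_add_invr e4; rewrite add0r => hN.
  exists N => i j Ni Nj.
  (* parallelogram law, and the lower bound of q at the midpoint *)
  have par : sqnorm (u i - u j) <= 2 * (q (u i) - m) + 2 * (q (u j) - m).
    have := q_inf ((2^-1)%:C%C *: (u i + u j)).
    rewrite /q !sqnormD sqnormN rdotNr fZ fD sqnormZ sqnormD; lra.
  have := uq i; have := uq j.
  have inv_le n : (N <= n)%N -> n.+1%:R^-1 <= N.+1%:R^-1 :> R.
    by move=> Nn; rewrite lef_pV2 ?posrE // ler_nat.
  have := inv_le _ Ni; have := inv_le _ Nj.
  move: i.+1%:R^-1 j.+1%:R^-1 N.+1%:R^-1 hN => a b c hN; lra.
exists l => x; rewrite rdotC; apply/eqP; rewrite eq_sym -subr_eq0; apply/eqP.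
set d := rdot l x - f x.
have var t : 0 <= t ^+ 2 * sqnorm x + 2 * t * d.
  have c : t ^+ 2 * sqnorm x + 2 * t * (rdot (u n) x - f x) + n.+1%:R^-1 @[n --> \oo]
      --> t ^+ 2 * sqnorm x + 2 * t * d + 0.
    apply: cvgD; last exact: cvg_harmonic.
    apply: cvgD; first exact: cvg_cst.
    by apply: cvgMr; apply: cvgB; [exact: cvg_rdot|exact: cvg_cst].
  rewrite -[leRHS]addr0; apply: (ler_cvg_to (@cvg_cst _ 0 _ _ _) c).
  apply: nearW => n; have := q_inf (u n + t%:C%C *: x); have := uq n.
  rewrite /q sqnormD sqnormZ rdotZr fD fZ; move: n.+1%:R^-1 => h; lra.
have N1 : 0 < sqnorm x + 1 by rewrite ltr_wpDl ?sqnorm_ge0.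
(* a step small enough for the linear term of the variation to dominate *)
have := var (- d / (sqnorm x + 1)).
have -> : (- d / (sqnorm x + 1)) ^+ 2 * sqnorm x + 2 * (- d / (sqnorm x + 1)) * d =
  - (d ^+ 2 * ((sqnorm x + 2) / (sqnorm x + 1) ^+ 2)).
  by field; rewrite gt_eqF.
rewrite oppr_ge0 pmulr_lle0; last first.
  by rewrite divr_gt0 ?exprn_gt0 // ltr_wpDl ?sqnorm_ge0.
by move=> d0; apply/eqP; rewrite -sqrf_eq0 eq_le d0 sqr_ge0.
Qed.

End RealInner.

(** * Adjoints and positive operators *)

Section Adjoint.
Context {R : realType} {H : hilbertType R}.
Implicit Types (x y z : H) (A B : bounded_op H).

Lemma opD A x y : A (x + y) = A x + A y.
Proof. by have := bounded_op_linear A 1 x y; rewrite !scale1r. Qed.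

Lemma op0 A : A 0 = 0.
Proof. by apply: (@addrI _ (A 0)); rewrite -opD !addr0. Qed.

Lemma opZ A a x : A (a *: x) = a *: A x.
Proof. by have := bounded_op_linear A a x 0; rewrite !addr0 op0 addr0. Qed.

Lemma op_bounded A : exists2 k : R, 0 < k & forall x, sqnorm (A x) <= k * sqnorm x.
Proof.
pose f : {linear H -> H} := HB.pack (A : H -> H)
  (GRing.isLinear.Build _ _ _ _ (A : H -> H) (bounded_op_linear A)).
have : bounded_near f (nbhs 0).
  by apply/linear_bounded_continuous; exact: bounded_op_continuous.
move=> /linear_boundedP /pinfty_ex_gt0 [r r0 fr].
have [a a0 aE] := posc_real r0; rewrite {r}aE in r0 fr.
exists (a ^+ 2) => [|x]; first exact: exprn_gt0.
rewrite -lecR rmorphM rmorphXn /= -!norm_sqnorm -exprMn.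
by rewrite ler_pXn2r ?nnegrE ?mulr_ge0 ?(ltW r0) // fr.
Qed.

Lemma bounded_opP (f : H -> H) (k : R) : 0 < k -> linear f ->
  (forall x, sqnorm (f x) <= k * sqnorm x) -> is_bounded_op f.
Proof.
move=> k0 lf fk; apply/asboolP; split=> //.
pose g : {linear H -> H} := HB.pack f (GRing.isLinear.Build _ _ _ _ f lf).
suff : continuous g by [].
apply/linear_bounded_continuous/linear_boundedP.
have s0 : 0 < Num.sqrt k by rewrite sqrtr_gt0.
near=> r => x; apply: (@le_trans _ _ ((Num.sqrt k)%:C%C * `|x|)).
  rewrite -(@ler_pXn2r _ 2) ?nnegrE ?mulr_ge0 ?ler0c ?(ltW s0) //.
  by rewrite exprMn !norm_sqnorm -rmorphXn -rmorphM lecR sqr_sqrtr ?(ltW k0) // fk.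
rewrite ler_wpM2r //; near: r; apply: nbhs_pinfty_ge.
by rewrite ger0_real // ler0c ltW.
Unshelve. all: by end_near. Qed.

Lemma adjoint_exists A : exists B, is_adjoint A B.
Proof.
have [k k0 Ak] := op_bounded A.
have ex y : exists z, forall x, rdot (A x) y = rdot x z.
  apply: (@riesz _ _ _ (k * sqnorm y)) => [|x x'|a x|x].
  - by rewrite mulr_ge0 ?sqnorm_ge0 // ltW.
  - by rewrite opD rdotDl.
  - by rewrite opZ rdotZl.
  - apply: le_trans (rdot_cauchy _ _) _; rewrite mulrAC.
    by rewrite ler_wpM2r ?sqnorm_ge0.
have [f fE] := boolp.choice ex.
have fl : linear f.
  move=> a x y; apply: rdot_inj => z; rewrite ![rdot _ z]rdotC -fE !rdotDr -fE.
  by rewrite !rdotZc -fE opZ.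
have fb y : sqnorm (f y) <= k * sqnorm y.
  have [->|N0] := eqVneq (sqnorm (f y)) 0; first by rewrite mulr_ge0 ?sqnorm_ge0 // ltW.
  have Np : 0 < sqnorm (f y) by rewrite lt_def N0 sqnorm_ge0.
  rewrite -(ler_pM2l Np) -expr2 {1}/sqnorm -fE.
  apply: le_trans (rdot_cauchy _ _) _.
  by rewrite mulrA [sqnorm (f y) * k]mulrC ler_wpM2r ?sqnorm_ge0.
exists (BoundedOp (bounded_opP k0 fl fb)) => x y /=.
by rewrite !inner_im /= !rdotZc -opZ !fE.
Qed.

Lemma adjP A : is_adjoint A (adj A).
Proof.
have [B AB] := adjoint_exists A.
exact: (xgetPex 0 (ex_intro _ B AB)).
Qed.

Lemma adjE A x y : rdot (A x) y = rdot x (adj A y).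
Proof. by rewrite /rdot adjP. Qed.

Lemma adj_unique A B : (forall x y, rdot (A x) y = rdot x (B y)) -> adj A = B.
Proof.
by move=> AB; apply: op_ext => y; apply: rdot_inj => x; rewrite !(rdotC _ x) -adjE AB.
Qed.

Lemma adjK : involutive (@adj R H).
Proof. by move=> A; apply: adj_unique => x y; rewrite rdotC -adjE rdotC. Qed.

Lemma adjD A B : adj (A + B) = adj A + adj B.
Proof. by apply: adj_unique => x y; rewrite op_addE rdotDl !adjE -rdotDr. Qed.

Lemma adjM A B : adj (A * B) = adj B * adj A.
Proof. by apply: adj_unique => x y; rewrite op_mulE !adjE. Qed.

Lemma adj_one : adj (1 : bounded_op H) = 1.
Proof. exact: adj_unique. Qed.

Lemma adjZr (a : R) A : adj (a%:C%C *: A) = a%:C%C *: adj A.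
Proof. by apply: adj_unique => x y; rewrite !op_scaleE rdotZl rdotZr adjE. Qed.

Definition op_i : bounded_op H := ('i%C : R[i]) *: (1 : bounded_op H).

Lemma adj_i : adj op_i = - op_i.
Proof.
apply: adj_unique => x y; rewrite rdotC rdotZc [RHS]rdotC; congr rdot.
rewrite -scaleNr; congr (_ *: _).
by apply/eqP; rewrite eq_complex /= oppr0 !eqxx.
Qed.


Lemma adjB A B : adj (A - B) = adj A - adj B.
Proof.
by apply: adj_unique => x y; rewrite rdotDl rdotNl !adjE -rdotNr -rdotDr.
Qed.

Lemma adj_proper A B : adj A * A + adj B * B = 0 -> A = 0.
Proof.
move=> e; apply: op_ext => x; apply: sqnorm_eq0; apply: le_anti; rewrite sqnorm_ge0 andbT.
have : rdot ((adj A * A + adj B * B) x) x = 0 by rewrite e /rdot linear0l.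
rewrite op_addE rdotDl !op_mulE -[adj A (A x)]/(adj A (A x)) !(rdotC _ x) -!adjE => <-.
by rewrite lerDl sqnorm_ge0.
Qed.

Lemma op_subE A B x : (A - B) x = A x - B x.
Proof. by []. Qed.

Definition pos A := adj A = A /\ forall x, 0 <= rdot (A x) x.

Lemma pos0 : pos 0.
Proof.
by split=> [|x]; [apply: adj_unique => x y; rewrite rdot0l rdotC | ]; rewrite rdot0l.
Qed.

Lemma posD A B : pos A -> pos B -> pos (A + B).
Proof.
move=> [As Ap] [Bs Bp]; split=> [|x]; first by rewrite adjD As Bs.
by rewrite op_addE rdotDl addr_ge0.
Qed.

Lemma posZ (a : R) A : 0 <= a -> pos A -> pos (a%:C%C *: A).
Proof.
move=> a0 [As Ap]; split=> [|x]; first by rewrite adjZr As.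
by rewrite op_scaleE rdotZl mulr_ge0.
Qed.

Lemma pos_conj A B : adj B = B -> pos A -> pos (B * A * B).
Proof.
move=> Bs [As Ap]; split=> [|x]; first by rewrite !adjM As Bs mulrA.
by rewrite !op_mulE adjE Bs.
Qed.

Lemma pos_sqr B : pos (adj B * B).
Proof.
split=> [|x]; first by rewrite adjM adjK.
by rewrite op_mulE rdotC -adjE sqnorm_ge0.
Qed.

Lemma pos1 : pos 1.
Proof. by split=> [|x]; [exact: adj_one | exact: sqnorm_ge0]. Qed.

Definition between01 A := pos A /\ pos (1 - A).

(** Positivity of A (1 - A) without square roots: expand A (1 - A) against
    A + (1 - A) = 1. *)
Lemma between01_mul A : between01 A -> pos (A * (1 - A)).
Proof.
move=> [pA p1A].
have -> : A * (1 - A) = A * (1 - A) * A + (1 - A) * A * (1 - A).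
  by ncring.
by apply: posD; apply: pos_conj => //; [case: pA | case: p1A].
Qed.

(** The inequality A^2 <= A, evaluated at x. *)
Lemma between01_contract A x : between01 A -> sqnorm (A x) <= rdot (A x) x.
Proof.
move=> uA; have [_ /(_ x)] := between01_mul uA; have [[As _] _] := uA.
have -> : A * (1 - A) = A - A * A by ncring.
by rewrite op_subE rdotDl rdotNl op_mulE [rdot (A (A x)) x]adjE As subr_ge0.
Qed.

Lemma between01B A : between01 A -> between01 (1 - A).
Proof. by move=> [pA p1A]; split=> //; rewrite subKr. Qed.

Lemma between01_sqnorm A x : between01 A -> sqnorm (A x) <= sqnorm x.
Proof.
move=> uA; apply: le_trans (between01_contract x uA) _.
have [_ [_ /(_ x)]] := uA.
by rewrite op_subE rdotDl rdotNl subr_ge0.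
Qed.

(** Induction in steps of two: B^(n+2) C = B (B^n C) B. *)
Lemma pos_pow B C n : pos B -> pos C -> pos (B * C) -> B * C = C * B ->
  pos (B ^+ n * C).
Proof.
move=> [Bs _] pC pBC BC; elim/ltn_ind: n => -[|[|n]] IH.
- by rewrite mul1r.
- by [].
have -> : B ^+ n.+2 * C = B * (B ^+ n * C) * B.
  rewrite exprS exprSr -!mulrA; congr (_ * (_ * _)).
  by rewrite BC.
by apply: pos_conj => //; exact: IH.
Qed.

Lemma pos_exp B n : pos B -> pos (B ^+ n).
Proof.
move=> pB; rewrite -[_ ^+ n]mulr1; apply: pos_pow; rewrite ?mulr1 ?mul1r //.
exact: pos1.
Qed.

Lemma between01_exp B n : between01 B -> between01 (B ^+ n) /\ pos (B ^+ n - B ^+ n.+1).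
Proof.
move=> uB; have [pB p1B] := uB.
have d k : pos (B ^+ k - B ^+ k.+1).
  have -> : B ^+ k - B ^+ k.+1 = B ^+ k * (1 - B) by rewrite exprSr; ncring.
  apply: pos_pow => //; first exact: between01_mul.
  by ncring.
split=> //; split; first exact: pos_exp.
elim: n => [|n IH]; first by rewrite subrr; exact: pos0.
have -> : 1 - B ^+ n.+1 = (1 - B ^+ n) + (B ^+ n - B ^+ n.+1) by ncring.
exact: posD.
Qed.

(** * Monotone limits *)

Lemma sqnorm_cvg (u : nat -> H) (l : H) :
  (forall e, 0 < e -> \forall n \near \oo, sqnorm (u n - l) < e) -> u @ \oo --> l.
Proof.
move=> h; apply/cvgrPdist_lt => e /posc_real [a a0 ->].
have := h _ (exprn_gt0 2 a0); apply: filterS => n.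
by rewrite norm_lt // -sqnormN opprB.
Qed.

Lemma cvg_op A (u : nat -> H) (l : H) : u @ \oo --> l -> A (u n) @[n --> \oo] --> A l.
Proof. by move=> ul; apply: cvg_comp ul _; exact: bounded_op_continuous. Qed.

Lemma cvg_uniq (u : nat -> H) (l l' : H) : u @ \oo --> l -> u @ \oo --> l' -> l = l'.
Proof. exact: cvg_unique. Qed.

(** The numbers <Y_n x, x> increase and stay below |x|^2; since D = Y_m - Y_n
    satisfies D^2 <= D, they control |Y_m x - Y_n x|^2, so Y_n x is Cauchy. A
    strong limit of elements of M is a weak limit, hence in M. *)
Lemma monotone_limit (M : set (bounded_op H)) (Y : nat -> bounded_op H) :
  weakly_closed M -> (forall n, M (Y n)) -> (forall n, between01 (Y n)) ->
  (forall n, pos (Y n.+1 - Y n)) ->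
  exists2 L, M L & forall x, Y n x @[n --> \oo] --> L x.
Proof.
move=> Mc MY uY incr.
have incr2 n k : pos (Y (n + k)%N - Y n).
  elim: k => [|k IH]; first by rewrite addn0 subrr; exact: pos0.
  rewrite addnS -[_ - _](subrKA (Y (n + k)%N)); exact: posD.
have ex x : exists l : H, Y n x @[n --> \oo] --> l.
  pose a n := rdot (Y n x) x.
  have step n k : sqnorm (Y (n + k)%N x - Y n x) <= a (n + k)%N - a n.
    have u : between01 (Y (n + k)%N - Y n).
      split=> //; have [_ p1] := uY (n + k)%N; have [p2 _] := uY n.
      by have := posD p1 p2; congr pos; ncring.
    by have := between01_contract x u; rewrite op_subE [rdot (_ - _) _]rdotDl rdotNl.
  have a_ub n : a n <= sqnorm x.
    by have [_ [_ /(_ x)]] := uY n; rewrite op_subE rdotDl rdotNl subr_ge0.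
  have sup_a : has_sup (range a).
    by split; [exists (a 0%N), 0%N | exists (sqnorm x) => _ [n _ <-]].
  apply: sqnorm_complete => e e0.
  have [_ [N _ <-] aN] := sup_adherent e0 sup_a; exists N.
  have close n k : (N <= n)%N -> sqnorm (Y (n + k)%N x - Y n x) < e.
    move=> Nn; apply: le_lt_trans (step n k) _.
    have : a (n + k)%N <= sup (range a).
      by apply: ub_le_sup; [case: sup_a | exists (n + k)%N].
    have : a N <= a n.
      rewrite -subr_ge0 -(subnKC Nn).
      by apply: le_trans (step N (n - N)%N); exact: sqnorm_ge0.
    lra.
  move=> m n Nm Nn; case: (leqP n m) => [nm|/ltnW mn].
    by rewrite -(subnKC nm) close.
  by rewrite -(subnKC mn) -sqnormN opprB close.
have [L LE] := boolp.choice ex.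
have Ll : linear L.
  move=> a x y; apply: cvg_uniq (LE _) _.
  have -> : (fun n => Y n (a *: x + y)) = (fun n => a *: Y n x + Y n y).
    by apply/funext => n; rewrite opD opZ.
  by apply: cvgD => //; apply: cvgZl_tmp.
have Lb x : sqnorm (L x) <= 1 * sqnorm x.
  have : sqnorm (L x) <= 2^-1 * (sqnorm x + sqnorm (L x)).
    have c := @cvg_rdot _ _ _ _ (L x) (LE x).
    apply: (ler_cvg_to c (@cvg_cst _ (2^-1 * (sqnorm x + sqnorm (L x))) _ _ _)).
    apply: nearW => n.
    have := sqnorm_ge0 (Y n x - L x); rewrite sqnormD sqnormN rdotNr.
    have := between01_sqnorm x (uY n); lra.
  lra.
exists (BoundedOp (bounded_opP ltr01 Ll Lb)) => //.
apply: Mc => s e e0; set T := BoundedOp _.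
have : \forall n \near \oo, forall p, p \in s ->
    `|inner (Y n p.1 - T p.1) p.2| < e%:C%C.
  elim: s => [|[x y] s IH]; first exact: nearW.
  have d0 : 0 < e ^+ 2 / (2 * (sqnorm y + 1)).
    by rewrite divr_gt0 ?exprn_gt0 // mulr_gt0 // ltr_wpDl ?sqnorm_ge0.
  have := cvg_sqnorm (LE x) d0; apply: filterS2 IH => n IH hn p.
  rewrite inE => /orP[/eqP-> /=|]; last exact: IH.
  have yp : 0 < 2 * (sqnorm y + 1) by rewrite mulr_gt0 // ltr_wpDl ?sqnorm_ge0.
  have := rdot_cauchy (Y n x - L x) y; have := rdot_cauchy (Y n x - L x) ('i%C *: y).
  rewrite ltr_pdivlMr // in hn.
  (* the modulus of an inner product is estimated through its two coordinates *)
  rewrite sqnorm_ii -(@ltr_pXn2r _ 2) ?nnegrE ?normr_ge0 ?ler0c ?(ltW e0) //.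
  rewrite -add_Re2_Im2 -rmorphXn ltcR inner_im /=.
  have := sqnorm_ge0 (Y n x - L x); have := sqnorm_ge0 y.
  move: hn; set w := Y n x - L x.
  set c := rdot w _; set d := rdot w y; move: (sqnorm w) (sqnorm y) => a b; nra.
move=> [N _ /(_ N (leqnn N)) hN]; by exists (Y N).
Qed.

End Adjoint.

(** * Projections in a von Neumann algebra *)

Section SpectralCalculus.
Context {R : realType} {H : hilbertType R} (M : set (bounded_op H)).
Hypothesis M_vna : von_neumann_algebra M.
Implicit Types (x y z : H) (A B P Q T X Y D L : bounded_op H).

Lemma vnaZ (a : R[i]) A : M A -> M (a *: A).
Proof.
move=> MA; have M1 := vna_one M_vna.
have M0 : M 0 by have := vna_linear M_vna (-1) M1 M1; rewrite scaleN1r addNr.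
by have := vna_linear M_vna a MA M0; rewrite addr0.
Qed.

Lemma vnaD A B : M A -> M B -> M (A + B).
Proof. by move=> MA MB; have := vna_linear M_vna 1 MA MB; rewrite scale1r. Qed.

Lemma vnaN A : M A -> M (- A).
Proof. by rewrite -scaleN1r; exact: vnaZ. Qed.

Lemma vnaB A B : M A -> M B -> M (A - B).
Proof. by move=> MA /vnaN; exact: vnaD. Qed.

Lemma vnaX A n : M A -> M (A ^+ n).
Proof.
move=> MA; elim: n => [|n IH]; first exact: vna_one.
by rewrite exprS; exact: vna_mul.
Qed.

Lemma op_mulZl (a : R[i]) A B : (a *: A) * B = a *: (A * B).
Proof. exact: op_ext. Qed.

Lemma op_mulZr (a : R[i]) A B : A * (a *: B) = a *: (A * B).
Proof. by apply: op_ext => x; rewrite op_mulE op_scaleE opZ. Qed.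

Lemma limit_adj (Y : nat -> bounded_op H) L : (forall n, adj (Y n) = Y n) ->
  (forall x, Y n x @[n --> \oo] --> L x) -> adj L = L.
Proof.
move=> Ys YL; apply: adj_unique => x y.
have c1 := @cvg_rdot _ _ _ _ y (YL x); have c2 := @cvg_rdot _ _ _ _ x (YL y).
rewrite [RHS]rdotC; apply: (cvg_unique _ c1); first exact: norm_hausdorff.
rewrite /=; apply: (cvg_trans _ c2); apply: near_eq_cvg; apply: nearW => n.
by rewrite adjE Ys rdotC.
Qed.

Lemma limit_pos (Y : nat -> bounded_op H) L : (forall n, pos (Y n)) ->
  (forall x, Y n x @[n --> \oo] --> L x) -> pos L.
Proof.
move=> pY YL; split=> [|x]; first by apply: limit_adj YL => n; case: (pY n).
apply: (ler_cvg_to (@cvg_cst _ 0 _ _ _) (@cvg_rdot _ _ _ _ x (YL x))).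
by apply: nearW => n; case: (pY n).
Qed.

Lemma limit_sqr (Y : nat -> bounded_op H) L x : (forall n, between01 (Y n)) ->
  (forall x, Y n x @[n --> \oo] --> L x) ->
  Y n (Y n x) @[n --> \oo] --> L (L x).
Proof.
move=> uY YL.
have -> : (fun n => Y n (Y n x)) = (fun n => Y n (Y n x - L x) + Y n (L x)).
  by apply/funext => n; rewrite -opD subrK.
rewrite -[L (L x)]add0r; apply: cvgD => //.
apply: sqnorm_cvg => e e0; have := cvg_sqnorm (YL x) e0; apply: filterS => n.
by rewrite subr0; apply: le_lt_trans; exact: between01_sqnorm.
Qed.

Lemma scale_half X : (2^-1)%:C%C *: X + (2^-1)%:C%C *: X = X :> bounded_op H.
Proof.
have e : 2^-1 + 2^-1 = 1 :> R by lra.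
by rewrite -scalerDl -rmorphD e rmorph1 scale1r.
Qed.

(** With B = 1 - adj T T / k and k large, 0 <= B <= 1 and the powers of B
    decrease to the projection on the kernel of 1 - B, which is that of T. *)
Lemma kernel_projection T : M T -> exists Q,
  [/\ M Q, projection Q, T * Q = 0 & forall X, T * X = 0 -> Q * X = X].
Proof.
move=> MT; have [k k0 Tk] := op_bounded T.
pose B := 1 - (k^-1)%:C%C *: (adj T * T).
have MB : M B.
  apply: vnaB; [exact: vna_one | apply: vnaZ; apply: vna_mul => //; exact: vna_adj].
have uB : between01 B.
  split; last first.
    by rewrite subKr; apply: posZ; [rewrite invr_ge0 ltW | exact: pos_sqr].
  split; first by rewrite adjB adj_one adjZr adjM adjK.
  move=> x; rewrite op_subE rdotDl rdotNl op_scaleE rdotZl op_mulE.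
  rewrite rdotC [rdot (adj T _) _]rdotC -adjE subr_ge0.
  by rewrite ler_pdivrMl // Tk.
pose Y n := 1 - B ^+ n.
have [L ML YL] : exists2 L, M L & forall x, Y n x @[n --> \oo] --> L x.
  apply: monotone_limit => [|n|n|n]; first exact: vna_closed.
  - by apply: vnaB; [exact: vna_one | exact: vnaX].
  - by apply: between01B; have [] := between01_exp n uB.
  - have [_] := between01_exp n uB; congr pos; rewrite /Y; ncring.
pose Q := 1 - L.
have BQ x : (B ^+ n) x @[n --> \oo] --> Q x.
  have -> : (fun n => (B ^+ n) x) = (fun n => x - Y n x).
    by apply/funext => n; rewrite /Y op_subE op_oneE subKr.
  by apply: cvgB; [exact: cvg_cst | exact: YL].
have BnX X : T * X = 0 -> forall n, B ^+ n * X = X.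
  move=> TX; elim=> [|n IH]; first by rewrite mul1r.
  rewrite exprSr -mulrA /B mulrBl mul1r op_mulZl -mulrA TX mulr0 scaler0 subr0 //.
have QX X : T * X = 0 -> Q * X = X.
  move=> TX; apply: op_ext => x; apply: (cvg_uniq (BQ (X x))).
  have -> : (fun n => (B ^+ n) (X x)) = (fun=> X x).
    by apply/funext => n; rewrite -op_mulE BnX.
  exact: cvg_cst.
have BQQ : B * Q = Q.
  apply: op_ext => x; rewrite op_mulE; apply: (cvg_uniq (cvg_op (A := B) (BQ x))).
  have -> : (fun n => B ((B ^+ n) x)) = (fun n => (B ^+ n.+1) x).
    by apply/funext => n; rewrite exprS.
  by have := BQ x; rewrite -(cvg_shiftS (fun n => (B ^+ n) x)).
have TQ : T * Q = 0.
  apply: (@adj_proper _ _ _ 0); rewrite mulr0 addr0.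
  have : (k^-1)%:C%C *: (adj T * T * Q) = 0.
      rewrite -(subrr Q) -{3}BQQ /B mulrBl mul1r op_mulZl; ncring.
  move/(congr1 (fun Z => k%:C%C *: Z)); rewrite scalerA -rmorphM.
  rewrite mulfV ?gt_eqF // scale1r scaler0.
  by move=> e; rewrite adjM -mulrA [adj T * _]mulrA e mulr0.
exists Q; split=> //; first by apply: vnaB => //; exact: vna_one.
split; first exact: QX.
by apply: (limit_adj _ BQ) => n; have [[[]]] := between01_exp n uB.
Qed.

(** Polynomials in B with nonnegative coefficients: positive if B is, and closed
    under products, which positive operators in general are not. *)
Inductive pos_poly B : bounded_op H -> Prop :=
| PosExp n : pos_poly B (B ^+ n)
| PosAdd X Y : pos_poly B X -> pos_poly B Y -> pos_poly B (X + Y)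
| PosScale (a : R) X : 0 <= a -> pos_poly B X -> pos_poly B (a%:C%C *: X).

Lemma pos_poly_pos B X : pos B -> pos_poly B X -> pos X.
Proof.
move=> pB; elim=> [n|Y Z _ pY _ pZ|a Y a0 _ pY]; first exact: pos_exp.
  exact: posD.
exact: posZ.
Qed.

Lemma pos_poly_mul B X Y : pos_poly B X -> pos_poly B Y -> pos_poly B (X * Y).
Proof.
move=> pX pY; elim: pX => [n|X1 X2 _ p1 _ p2|a Z a0 _ p]; last 2 first.
- by rewrite mulrDl; exact: PosAdd.
- by rewrite op_mulZl; exact: PosScale.
elim: pY => [m|X1 X2 _ p1 _ p2|a Z a0 _ p].
- by rewrite -exprD; exact: PosExp.
- by rewrite mulrDr; exact: PosAdd.
- by rewrite op_mulZr; exact: PosScale.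
Qed.

Lemma pos_poly_comm B X T : T * B = B * T -> pos_poly B X -> T * X = X * T.
Proof.
move=> TB; elim=> [n|Y Z _ pY _ pZ|a Y a0 _ pY].
- exact: (commrX n TB).
- by rewrite mulrDl mulrDr pY pZ.
- by rewrite op_mulZl op_mulZr pY.
Qed.

Lemma pos_poly_vna B X : M B -> pos_poly B X -> M X.
Proof.
move=> MB; elim=> [n|Y Z _ pY _ pZ|a Y a0 _ pY]; first exact: vnaX.
  exact: vnaD.
exact: vnaZ.
Qed.

(** The iteration Y_(n+1) = (B + Y_n^2) / 2 with B = 1 - T^2 and Y_0 = 0
    increases, its increments being products (Y_n + Y_(n-1)) (Y_n - Y_(n-1)) / 2 of
    nonnegative polynomials in B; its limit L satisfies (1 - L)^2 = T^2. *)
Lemma absolute_value T : M T -> adj T = T -> between01 (1 - T * T) ->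
  exists S, [/\ M S, pos S, S * S = T * T & S * T = T * S].
Proof.
move=> MT Ts uB; set B := 1 - T * T in uB.
have MB : M B by apply: vnaB; [exact: vna_one | exact: vna_mul].
have TB : T * B = B * T by rewrite /B; ncring.
have [pB p1B] := uB.
pose Y := fix Y n := if n is m.+1 then (2^-1)%:C%C *: (B + Y m * Y m) else 0.
have h0 : 0 <= 2^-1 :> R by rewrite invr_ge0.
have pY n : pos_poly B (Y n).
  elim: n => [|n IH] /=.
    by rewrite -(scale0r (B ^+ 0)); apply: PosScale => //; exact: PosExp.
  apply: PosScale => //; apply: PosAdd; last exact: pos_poly_mul.
  exact: (PosExp B 1).
have uY n : between01 (Y n).
  elim: n => [|n IH].
    by split; [exact: pos0 | rewrite subr0; exact: pos1].
  split; first exact: pos_poly_pos (pY _).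
  have -> : 1 - Y n.+1 = (2^-1)%:C%C *: ((1 - B) + (1 - Y n) + Y n * (1 - Y n)).
    rewrite -[X in X - _](scale_half 1) -scalerDr -scalerBr; congr (_ *: _); ncring.
  apply: posZ => //; apply: posD; last exact: between01_mul.
  by apply: posD => //; case: IH.
have incr n : pos_poly B (Y n.+1 - Y n).
  elim: n => [|n IH]; first by rewrite subr0; exact: pY.
  have -> : Y n.+2 - Y n.+1 = (2^-1)%:C%C *: ((Y n.+1 + Y n) * (Y n.+1 - Y n)).
    have c : Y n.+1 * Y n = Y n * Y n.+1.
      by apply: pos_poly_comm (pY _); rewrite -(pos_poly_comm _ (pY _)).
    rewrite -[LHS]/((2^-1)%:C%C *: (B + Y n.+1 * Y n.+1)
                    - (2^-1)%:C%C *: (B + Y n * Y n)).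
    by rewrite -scalerBr; congr (_ *: _); combine (gap c).
  apply: PosScale => //; apply: pos_poly_mul => //; exact: PosAdd.
have [L ML YL] := @monotone_limit _ _ M Y (vna_closed M_vna)
  (fun n => pos_poly_vna MB (pY n)) uY (fun n => pos_poly_pos pB (incr n)).
have uL : between01 L.
  split; first by apply: limit_pos YL => n; case: (uY n).
  apply: (@limit_pos (fun n => 1 - Y n)) => [n|x]; first by case: (uY n).
  by apply: cvgB; [exact: cvg_cst | exact: YL].
have LE : L + L = B + L * L.
  rewrite -[RHS]scale_half; suff <- : L = (2^-1)%:C%C *: (B + L * L) by [].
  apply: op_ext => x; apply: (cvg_uniq (u := fun n => Y n.+1 x)).
    by rewrite (cvg_shiftS (fun n => Y n x)).
  apply: cvgZl_tmp; apply: cvgD; first exact: cvg_cst.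
  exact: limit_sqr.
have LT : T * L = L * T.
  apply: op_ext => x; apply: (cvg_uniq (cvg_op (A := T) (YL x))).
  have -> : (fun n => T (Y n x)) = (fun n => Y n (T x)).
    by apply/funext => n; rewrite -!op_mulE (pos_poly_comm TB (pY n)).
  exact: YL.
exists (1 - L); split.
- by apply: vnaB => //; exact: vna_one.
- by case: uL.
- by rewrite /B in LE; combine (- gap LE).
- combine (gap LT).
Qed.

(** P is the projection on the kernel of S - T, where S = |T| and T = 2 A - 1.
    As (S - T) (S + T) = 0, one has T = S on the range of P and T = - S on its
    complement, which gives the bounds on A1 = T + (1 - P). *)
Lemma dyadic_step A : M A -> between01 A -> exists P A1,
  [/\ M P, projection P, M A1, between01 A1 & A + A = P + A1].
Proof.
move=> MA uA; have [[As _] _] := uA; pose T := A + A - 1.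
have MT : M T by apply: vnaB; [exact: vnaD | exact: vna_one].
have Ts : adj T = T by rewrite /T adjB adjD As adj_one.
have uT : between01 (1 - T * T).
  split; last by rewrite subKr -{1}Ts; exact: pos_sqr.
  have p := posD (between01_mul uA) (between01_mul uA).
  have := posD p p; congr pos; rewrite /T; ncring.
have [S [MS [Ss Sp] SS ST]] := absolute_value MT Ts uT.
have [P [MP [PP Ps] TP0 PX]] := kernel_projection (vnaB MS MT).
have PST : P * (S + T) = S + T by apply: PX; combine (gap SS + gap ST).
have STP : (S + T) * P = S + T.
  by move/(congr1 adj): PST; rewrite adjM adjD Ss Ts Ps.
have P's : adj (1 - P) = 1 - P by rewrite adjB adj_one Ps.
have TPS : T * P = S * P by combine (- gap TP0).
have PTS : P * T = P * S.
  by move/(congr1 adj): TPS; rewrite !adjM Ss Ts Ps.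
have PTC : T * P = P * T.
  have e : T * P + T * P = P * T + P * T.
    combine (gap STP + gap TPS - gap PST - gap PTS).
  by rewrite -[LHS]scale_half -scalerDr e scalerDr scale_half.
have AA : A + A = T + 1 by rewrite /T; ncring.
have A1A : (1 - A) + (1 - A) = 1 - T by rewrite /T; ncring.
have [pA p1A] := uA.
exists P, (T + (1 - P)); split=> //.
- by apply: vnaD => //; apply: vnaB => //; exact: vna_one.
- split.
    have -> : T + (1 - P) = P * S * P + (1 - P) * (A + A) * (1 - P).
      rewrite AA; combine (- gap PP - gap PST * P - gap PTC + gap TPS).
    by apply: posD; apply: pos_conj => //; exact: posD.
  have -> : 1 - (T + (1 - P)) = P * ((1 - A) + (1 - A)) * P + (1 - P) * S * (1 - P).
    rewrite A1A; combine (- gap PP + P * gap TPS - gap PTC - gap PTS + gap STP).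
  by apply: posD; apply: pos_conj => //; exact: posD.
- rewrite /T; ncring.
Qed.

Lemma rdot_mulrn X m x z : rdot ((X *+ m) x) z = rdot (X x) z *+ m.
Proof.
elim: m => [|m IH]; first by rewrite !mulr0n rdot0l.
by rewrite !mulrS op_addE rdotDl IH.
Qed.

Definition commutes_with_projections D :=
  forall P, M P -> projection P -> D * P = P * D.

(** By repeated dyadic steps, 2^n [D, A] = [D, X] with 0 <= X <= 1; the right
    side is bounded independently of n. *)
Lemma comm_between01 D A : commutes_with_projections D -> M A -> between01 A ->
  D * A = A * D.
Proof.
move=> DP MA uA; pose br X := D * X - X * D.
have halving n : exists2 X, M X /\ between01 X & br X = br A *+ (2 ^ n).
  elim: n => [|n [X [MX uX] XE]]; first by exists A.
  have [P [X1 [MP Pp MX1 uX1 e]]] := dyadic_step MX uX.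
  exists X1 => //; rewrite expnS mul2n -addnn mulrnDr -XE /br.
  combine (- D * gap e + gap e * D - gap (DP _ MP Pp)).
apply/subr0_eq/op_ext => x; apply/rdot_inj => z; rewrite rdot0l.
have [k k0 Dk] := op_bounded D.
pose r := rdot (br A x) z; pose c := k * sqnorm x + sqnorm z.
have bound n : `|r| * n%:R <= c.
  have [X [MX uX] XE] := halving n.
  have e : rdot (br X x) z = r *+ (2 ^ n) by rewrite XE rdot_mulrn.
  have : `|rdot (br X x) z| <= c.
    rewrite /br op_subE !op_mulE rdotDl rdotNl ler_norml /c.
    have n1 := sqnorm_ge0 (D (X x) - z); have n2 := sqnorm_ge0 (D (X x) + z).
    have n3 := sqnorm_ge0 (X (D x) - z); have n4 := sqnorm_ge0 (X (D x) + z).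
    move: n1 n2 n3 n4; rewrite !sqnormD !sqnormN !rdotNr.
    have d1 := Dk (X x); have d2 := Dk x.
    have d3 := between01_sqnorm x uX; have d4 := between01_sqnorm (D x) uX.
    have d5 : k * sqnorm (X x) <= k * sqnorm x by rewrite ler_pM2l.
    by move=> n1 n2 n3 n4; apply/andP; split; lra.
  apply: le_trans; rewrite e normrMn -[_ *+ (2 ^ n)]mulr_natr ler_wpM2l // ler_nat.
  exact: ltnW (ltn_expl _ _).
apply/eqP; rewrite -[_ == 0]negbK -normr_gt0 -/(br A) -/r; apply/negP => r0.
have c0 : 0 <= c / `|r|.
  by rewrite divr_ge0 // /c addr_ge0 ?sqnorm_ge0 // mulr_ge0 ?sqnorm_ge0 // ltW.
have := archi_boundP c0; rewrite ltr_pdivrMr // mulrC ltNge bound //.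
Qed.

(** A self-adjoint A is brought between 0 and 1 by an affine change; a general
    one is split into A + adj A and i (A - adj A). *)
Lemma proj_commute_central D A : commutes_with_projections D -> M A ->
  D * A = A * D.
Proof.
move=> DP MA.
have dbl (X Y : bounded_op H) : X + X = Y + Y -> X = Y.
  by move=> e; rewrite -[LHS]scale_half -scalerDr e scalerDr scale_half.
have sa B : M B -> adj B = B -> D * B = B * D.
  move=> MB Bs; have [k k0 Bk] := op_bounded B.
  have k1 : 0 < k + 1 by lra.
  pose t := (k + 1)^-1; have t0 : 0 < t by rewrite invr_gt0.
  have small x : t * rdot (B x) x <= 2^-1 * sqnorm x /\
                 - (t * rdot (B x) x) <= 2^-1 * sqnorm x.
    have := sqnorm_ge0 (B x - x); have := sqnorm_ge0 (B x + x).
    rewrite !sqnormD sqnormN rdotNr.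
    have := Bk x; rewrite -mulrN ![t * _]mulrC !ler_pdivrMr //; split; nra.
  pose U : bounded_op H := (2^-1)%:C%C *: (1 : bounded_op H) + t%:C%C *: B.
  have MU : M U by apply: vnaD; apply: vnaZ => //; exact: vna_one.
  have UE : 1 - U = (2^-1)%:C%C *: (1 : bounded_op H) - t%:C%C *: B.
    by rewrite /U -[X in X - _](scale_half 1); ncring.
  have uU : between01 U.
    split; [|rewrite UE]; split.
    - by rewrite /U adjD !adjZr adj_one Bs.
    - move=> x; rewrite op_addE rdotDl !op_scaleE !rdotZl op_oneE -/(sqnorm x).
      have [] := small x; lra.
    - by rewrite adjB !adjZr adj_one Bs.
    - move=> x; rewrite op_subE rdotDl rdotNl !op_scaleE !rdotZl op_oneE -/(sqnorm x).
      have [] := small x; lra.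
  have := comm_between01 DP MU uU.
  rewrite /U mulrDl mulrDr !op_mulZl !op_mulZr mulr1 mul1r => /addrI.
  move/(congr1 (fun Z => (k + 1)%:C%C *: Z)); rewrite !scalerA -rmorphM /t.
  rewrite mulfV ?gt_eqF //.
  by rewrite !scale1r.
have e1 : D * (A + adj A) = (A + adj A) * D.
  by apply: sa; [apply: vnaD => //; exact: vna_adj | rewrite adjD adjK addrC].
have e2 : D * (op_i * (A - adj A)) = op_i * (A - adj A) * D.
  apply: sa.
    rewrite op_mulZl mul1r; apply: vnaZ; apply: vnaB => //; exact: vna_adj.
  rewrite adjM adj_i adjB adjK /op_i mulrN op_mulZl op_mulZr mul1r mulr1.
  by rewrite -scalerN opprB.
have e3 : D * (A - adj A) = (A - adj A) * D.
  move: e2; rewrite /op_i !op_mulZl op_mulZr mul1r.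
  move/(congr1 (fun Z => (- ('i%C : R[i])) *: Z)); rewrite !scalerA.
  have -> : - 'i%C * 'i%C = 1 :> R[i] by rewrite mulNr -expr2 sqr_i opprK.
  by rewrite !scale1r.
apply: dbl.
combine (gap e1 + gap e3).
Qed.

Hypothesis noI1 : no_central_summand_type_I1 M.

(** Under the hypothesis each Z A commutes with all projections, so it is
    central and the summand M Z is commutative, that is, of type I_1 with the
    single abelian projection Z. *)
Lemma central_proj_comm_eq0 Z : central_projection M Z ->
  (forall P A, M P -> projection P -> M A -> Z * (P * A - A * P) = 0) -> Z = 0.
Proof.
move=> Zc ZPA; have [MZ Zp ZC] := Zc; apply/eqP; apply/negPn/negP => Z0.
apply: (noI1 Zc Z0); exists (fun=> Z).
have ZMC A B : M A -> M B -> Z * A * B = B * (Z * A).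
  move=> MA MB; apply: proj_commute_central => // [P MP Pp].
  have MZA : M (Z * A) by exact: vna_mul.
  combine (- gap (ZPA _ _ MP Pp MA) + gap (ZC _ MP) * A).
have Zsum : central_summand M Z Z by exists 1; [exact: vna_one | rewrite mul1r].
split.
- move=> _; split=> // A B [A' MA' <-] [B' MB' <-].
  have [ZZ _] := Zp.
  have e C : M C -> Z * (C * Z) * Z = Z * C.
    by move=> MC; rewrite -(ZC _ MC) !mulrA ZZ -mulrA -(ZC _ MC) mulrA ZZ.
  by rewrite !e // ZMC //; exact: vna_mul.
- move=> _ _; exists Z => //; have [ZZ Zs] := Zp; by rewrite Zs ZZ.
- by move=> i j; rewrite !ord1.
- by rewrite big_ord1.
Qed.

(** The kernel projection Q of a central element is central, and 1 - Q
    inherits the annihilation property. *)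
Lemma central_annihilator C : M C -> (forall A, M A -> C * A = A * C) ->
  (forall P A, M P -> projection P -> M A -> C * (P * A - A * P) = 0) -> C = 0.
Proof.
move=> MC CC CPA; have [Q [MQ Qp CQ QX]] := kernel_projection MC.
have [QQ Qs] := Qp.
have QA A : M A -> Q * A * Q = A * Q.
  move=> MA; rewrite -mulrA; apply: QX; rewrite mulrA CC // -mulrA CQ mulr0 //.
have QC A : M A -> Q * A = A * Q.
  move=> MA; have := QA _ (vna_adj M_vna MA) => /(congr1 adj).
  by rewrite !adjM adjK Qs mulrA QA // => ->.
suff : 1 - Q = 0 by move/subr0_eq=> e; rewrite -[C]mulr1 e CQ.
have M1Q : M (1 - Q) by apply: vnaB => //; exact: vna_one.
apply: central_proj_comm_eq0 => [|P A MP Pp MA].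
  split=> //; first split.
  - combine (gap QQ).
  - by rewrite adjB adj_one Qs.
  - by move=> A MA; combine (- gap (QC _ MA)).
by rewrite mulrBl mul1r (QX _ (CPA _ _ MP Pp MA)) subrr.
Qed.
End SpectralCalculus.

(** * The von Neumann algebra as a star-ring *)

Section AlgebraType.
Context {R : realType} {H : hilbertType R} (M : set (bounded_op H)).
Hypothesis M_vna : von_neumann_algebra M.

(** The membership predicate takes the proof that M is a von Neumann algebra as an
    argument, so that the ring structure of the subtype can be inferred. *)
Definition vna_mem (_ : von_neumann_algebra M) : {pred bounded_op H} :=
  fun A => `[< M A >].

Record vna_elt := VnaElt { vna_val : bounded_op H ; _ : vna_mem M_vna vna_val }.

HB.instance Definition _ := [isSub for vna_val].
HB.instance Definition _ := [Choice of vna_elt by <:].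

Lemma vna_subring : subring_closed (vna_mem M_vna).
Proof.
split=> [|A B /asboolP MA /asboolP MB|A B /asboolP MA /asboolP MB]; apply/asboolP.
- exact: vna_one.
- exact: vnaB.
- exact: vna_mul.
Qed.

HB.instance Definition _ := GRing.SubChoice_isSubPzRing.Build
  (bounded_op H) (vna_mem M_vna) vna_elt vna_subring.

Definition elt A (MA : M A) : vna_elt :=
  VnaElt (introT (asboolP _) MA : vna_mem M_vna A).

Lemma eltP (a : vna_elt) : M (vna_val a).
Proof. exact: (asboolW (valP a)). Qed.

Definition star (a : vna_elt) : vna_elt := elt (vna_adj M_vna (eltP a)).
Definition elt_i : vna_elt := elt (vnaZ M_vna ('i%C : R[i]) (vna_one M_vna)).
Definition elt_half : vna_elt :=
  elt (vnaZ M_vna ((2^-1)%:C%C : R[i]) (vna_one M_vna)).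

Implicit Types a b : vna_elt.

Lemma elt_inj : injective vna_val. Proof. exact: val_inj. Qed.

Lemma elt_eq a b : a = b -> vna_val a = vna_val b. Proof. by move->. Qed.
Lemma eltD a b : vna_val (a + b) = vna_val a + vna_val b.
Proof. exact: (raddfD val). Qed.

Lemma eltN a : vna_val (- a) = - vna_val a. Proof. exact: (raddfN val). Qed.
Lemma eltM a b : vna_val (a * b) = vna_val a * vna_val b.
Proof. exact: (rmorphM val). Qed.

Lemma elt1 : vna_val (1 : vna_elt) = 1. Proof. exact: (rmorph1 val). Qed.
Lemma elt0 : vna_val (0 : vna_elt) = 0. Proof. exact: (raddf0 val). Qed.

Lemma elt_star a : vna_val (star a) = adj (vna_val a). Proof. by []. Qed.
Let eltE := (eltD, eltN, eltM, elt1, elt0, elt_star).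

Lemma star_eltD a b : star (a + b) = star a + star b.
Proof. by apply: elt_inj; rewrite !eltE adjD. Qed.

Lemma star_eltM a b : star (a * b) = star b * star a.
Proof. by apply: elt_inj; rewrite !eltE adjM. Qed.

Lemma star_eltK : involutive star.
Proof. by move=> a; apply: elt_inj; rewrite !eltE adjK. Qed.

Lemma star_elt_proper a b : star a * a + star b * b = 0 -> a = 0.
Proof.
move=> /elt_eq; rewrite !eltE => e.
by apply: elt_inj; rewrite elt0; exact: adj_proper e.
Qed.

Lemma elt_iE : elt_i * elt_i = -1.
Proof.
apply: elt_inj; rewrite eltM eltN elt1 /= op_mulZl mul1r scalerA -expr2 sqr_i.
by rewrite scaleN1r.
Qed.

Lemma elt_iC a : elt_i * a = a * elt_i.
Proof. by apply: elt_inj; rewrite !eltM /= op_mulZl op_mulZr mul1r mulr1. Qed.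

Lemma star_elt_i : star elt_i = - elt_i.
Proof. by apply: elt_inj; rewrite eltN /= adj_i. Qed.

Lemma elt_halfE : elt_half + elt_half = 1.
Proof. by apply: elt_inj; rewrite eltD elt1 /= scale_half. Qed.

Lemma elt_proj_central a : (forall p, is_proj star p -> a * p = p * a) -> central a.
Proof.
move=> ap b; apply: elt_inj; rewrite !eltM.
apply: (proj_commute_central M_vna _ (eltP b)) => P MP [PP Ps].
have := ap (elt MP); rewrite /is_proj => /(_ _)/elt_eq.
by rewrite !eltM; apply; split; apply: elt_inj.
Qed.

Lemma elt_proj_ann (noI1 : no_central_summand_type_I1 M) a : central a ->
  (forall p b, is_proj star p -> a * (p * b - b * p) = 0) -> a = 0.
Proof.
move=> ac ap; apply: elt_inj; rewrite elt0.
apply: (central_annihilator M_vna noI1 (eltP a)) => [B MB|P B MP [PP Ps] MB].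
  by have := congr1 vna_val (ac (elt MB)); rewrite !eltM.
have pp : is_proj star (elt MP).
  by split; apply: elt_inj => //; rewrite eltM.
by have := congr1 vna_val (ap _ (elt MB) pp); rewrite elt0 !(eltM, eltD, eltN).
Qed.

End AlgebraType.
(** * Reduction to binary products *)

Section Main.
Context {R : realType} {H : hilbertType R} (M : set (bounded_op H)).
Implicit Types (A B C : bounded_op H).

Lemma star_jordan_mulrnl A B n : star_jordan (A *+ n) B = star_jordan A B *+ n.
Proof.
have adjMn : adj (A *+ n) = adj A *+ n.
  elim: n => [|n IH]; last by rewrite !mulrS adjD IH.
  by rewrite !mulr0n; have [] := @pos0 R H.
by rewrite /star_jordan adjMn mulrnAl mulrnAr mulrnDl.
Qed.

Lemma star_jordan1l A : star_jordan 1 A = A *+ 2.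
Proof. by rewrite /star_jordan adj_one mul1r mulr1. Qed.

(** Each product with 1 on the left doubles. *)
Lemma qstar_ones m A B :
  qstar (nseq m 1 ++ [:: A; B]) = star_jordan A B *+ 2 ^ m.
Proof.
case: m => [|m] //=.
have : forall k, foldl star_jordan (1 *+ k) (nseq m 1 ++ [:: A; B]) =
    star_jordan A B *+ (k * 2 ^ m.+1).
  elim: m => [|m IH] k /=.
    by rewrite star_jordan_mulrnl star_jordan1l -mulrnA star_jordan_mulrnl mulnC expn1.
  rewrite star_jordan_mulrnl star_jordan1l -mulrnA IH; congr (_ *+ _).
  by rewrite [in RHS]expnS mulnA [(k * 2)%N]mulnC.
by move/(_ 1%N); rewrite mul1n.
Qed.

Lemma op_pow2_inj m A B : A *+ 2 ^ m = B *+ 2 ^ m -> A = B.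
Proof.
elim: m => [|m IH] //; rewrite expnSr !mulrnA !mulr2n => e; apply: IH.
by rewrite -[LHS]scale_half -scalerDr e scalerDr scale_half.
Qed.

(** Comparing the n-fold products ending in (A, B) and in (1, C) removes the
    powers of 2, although phi is not known to be homogeneous. *)
Lemma jordan_of_nmap (phi : bounded_op H -> bounded_op H) n A B C :
  M 1 -> (2 <= n)%N -> phi 1 = 1 -> multiplicative_star_jordan_map n M phi ->
  M A -> M B -> M C -> C + C = star_jordan A B ->
  phi C + phi C = star_jordan (phi A) (phi B).
Proof.
move=> M1 n2 phi1 phiq MA MB MC e; set m := (n - 2)%N.
have q X Y : M X -> M Y ->
    phi (star_jordan X Y *+ 2 ^ m) = star_jordan (phi X) (phi Y) *+ 2 ^ m.
  move=> MX MY; pose s := nseq m (1 : bounded_op H) ++ [:: X; Y].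
  have sz : size s == n by rewrite size_cat size_nseq /= subnK.
  have := phiq (Tuple sz); rewrite /= map_cat map_nseq phi1 !qstar_ones; apply=> i.
  rewrite (tnth_nth 0) /=; have : nth 0 s i \in s by rewrite mem_nth // (eqP sz).
  by rewrite mem_cat mem_nseq !inE => /orP[/andP[_ /eqP->]|/orP[]/eqP->].
have := q _ _ M1 MC; rewrite phi1 !star_jordan1l mulr2n e q // mulr2n => e'.
by apply: (@op_pow2_inj m).
Qed.

Lemma star_ring_iso_of_jordan (M_vna : von_neumann_algebra M)
    (noI1 : no_central_summand_type_I1 M) (phi : bounded_op H -> bounded_op H) :
  set_bij M M phi -> phi 1 = 1 ->
  (forall A B C, M A -> M B -> M C -> C + C = star_jordan A B ->
     phi C + phi C = star_jordan (phi A) (phi B)) ->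
  star_ring_isomorphism M phi.
Proof.
move=> bij phi1 phiJ; have [phiM phi_inj phi_surj] := bij.
pose E := vna_elt M_vna.
have phiM' (a : E) : M (phi (vna_val a)) by exact: (phiM _ (eltP a)).
pose f (a : E) : E := elt M_vna (phiM' a).
have fE a : vna_val (f a) = phi (vna_val a) by [].
have f_surj (b : E) : exists a : E, f a = b.
  have [A MA Ab] := phi_surj (vna_val b) (eltP b).
  by exists (elt M_vna MA); exact: elt_inj.
have [g gK] := boolp.choice f_surj.
have f_inj : injective f.
  move=> a b /elt_eq /= e; apply: elt_inj.
  by apply: phi_inj e; rewrite inE; exact: eltP.
have fK : cancel f g by move=> a; apply: f_inj.
have fg : jordan_pair (@star _ _ _ M_vna) f g.
  split=> //; first by apply: elt_inj; rewrite fE elt1.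
  move=> a b c e; apply: elt_inj; rewrite !(eltD, eltM, elt_star, fE).
  apply: phiJ; try exact: eltP.
  by have := elt_eq e; rewrite !(eltD, eltM).
have [fD fM fS] := jordan_pair_star_morphism (@star_eltD _ _ _ M_vna)
  (@star_eltM _ _ _ M_vna) (@star_eltK _ _ _ M_vna) (@star_elt_proper _ _ _ M_vna)
  (elt_iE M_vna) (@elt_iC _ _ _ M_vna) (star_elt_i M_vna) (elt_halfE M_vna)
  (@elt_proj_central _ _ _ M_vna) (elt_proj_ann noI1) fg.
split=> // [A B MA MB|A B MA MB|A MA].
- by have := elt_eq (fD (elt M_vna MA) (elt M_vna MB)); rewrite eltD !fE eltD.
- by have := elt_eq (fM (elt M_vna MA) (elt M_vna MB)); rewrite eltM !fE eltM.
- by have := elt_eq (fS (elt M_vna MA)); rewrite elt_star !fE elt_star.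
Qed.

Lemma star_ring_iso_unital (M1 : M 1) (phi : bounded_op H -> bounded_op H) :
  star_ring_isomorphism M phi -> phi 1 = 1.
Proof.
move=> [[_ _ surj] _ phiM _]; have [B MB B1] := surj 1 M1.
by rewrite -[LHS]mulr1 -{2}B1 -phiM // mul1r B1.
Qed.

Lemma star_ring_iso_nmap (M_vna : von_neumann_algebra M)
    (phi : bounded_op H -> bounded_op H) n :
  (0 < n)%N -> star_ring_isomorphism M phi -> multiplicative_star_jordan_map n M phi.
Proof.
move=> n0 [_ phiD phiM phiS] x Mx.
have sjM A B : M A -> M B -> M (star_jordan A B).
  by move=> MA MB; apply: vnaD => //; apply: vna_mul => //; exact: vna_adj.
have phi_sj A B : M A -> M B -> phi (star_jordan A B) = star_jordan (phi A) (phi B).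
  move=> MA MB; have MA' := vna_adj M_vna MA.
  by rewrite /star_jordan phiD ?phiM ?phiS //; exact: vna_mul.
have : forall A, A \in tval x -> M A by move=> A /tnthP[i ->].
case: x {Mx} => -[|A s] /= sz; first by rewrite eq_sym -leqn0 leqNgt n0 in sz.
rewrite /qstar /= => Ms.
have {Ms}[MA Ms] : M A /\ forall B, B \in s -> M B.
  by split=> [|B Bs]; apply: Ms; rewrite inE ?eqxx // Bs orbT.
elim: s A MA Ms {sz} => [|B s IH] A MA Ms //=.
have MB : M B by apply: Ms; rewrite inE eqxx.
rewrite -phi_sj // -IH //; first exact: sjM.
by move=> C Cs; apply: Ms; rewrite inE Cs orbT.
Qed.
End Main.

Theorem corollary3p3 (R : realType) (H : hilbertType R) (M : set (bounded_op H))
    (M_vna : von_neumann_algebra M) (M_noI1 : no_central_summand_type_I1 M)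
    (n : nat) (n_ge2 : (2 <= n)%N) (phi : {fun M >-> M}) :
  [/\ set_bij M M phi, phi 1 = 1 & multiplicative_star_jordan_map n M phi] <->
  star_ring_isomorphism M phi.
Proof.
have M1 := vna_one M_vna.
split=> [[bij phi1 phin]|iso].
  apply: star_ring_iso_of_jordan => // A B C.
  exact: (jordan_of_nmap M1 n_ge2 phi1 phin).
split; first by case: iso.
  exact: star_ring_iso_unital iso.
by apply: star_ring_iso_nmap iso => //; exact: ltnW.
Qed.
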